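(* Let $T\in(0,\infty)$ be fixed. If $\alpha>\frac12$, then $$\mathsf{P}\left(\limsup_{t\uparrow T}\frac{X_t^{(\alpha)}}{\sqrt{\frac{2(T-t)}{2\alpha-1}\ln\left(\ln\frac{1}{T-t}\right)}}=1\right)=\mathsf{P}\left(\liminf_{t\uparrow T}\frac{X_t^{(\alpha)}}{\sqrt{\frac{2(T-t)}{2\alpha-1}\ln\left(\ln\frac{1}{T-t}\right)}}=-1\right)=1.$$ Especially, $$\mathsf{P}\left(\limsup_{t\uparrow T}\frac{X_t^{(\alpha)}}{(T-t)^\alpha}=\infty\right)=\mathsf{P}\left(\liminf_{t\uparrow T}\frac{X_t^{(\alpha)}}{(T-t)^\alpha}=-\infty\right)=1.$$
   Context: Let $(B_t)_{t\geq 0}$ be a one-dimensional standard Wiener process on a probability space $(\Omega,\mathcal{A},\mathsf{P})$ (with a filtration constructed from $B$ satisfying the usual conditions). For $\alpha\in\mathbb{R}$, $(X_t^{(\alpha)})_{t\in[0,T)}$ denotes the unique strong solution (with continuous paths) of the SDE $$\mathrm{d}X_t^{(\alpha)}=-\frac{\alpha}{T-t}X_t^{(\alpha)}\,\mathrm{d}t+\mathrm{d}B_t,\quad t\in[0,T),\qquad X_0^{(\alpha)}=0,$$ namely $X_t^{(\alpha)}=\int_0^t\left(\frac{T-t}{T-s}\right)^\alpha\mathrm{d}B_s$, $t\in[0,T)$. The normalizing expressions with iterated logarithms are considered only for $t$ sufficiently close to $T$, where they are well defined and positive. *)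

(* Defs.v *)
From HB Require Import structures.
From mathcomp Require Import all_boot all_order all_algebra.
From mathcomp Require Import all_classical all_reals all_analysis.

Set Implicit Arguments.
Unset Strict Implicit.
Unset Printing Implicit Defensive.

Import Order.TTheory GRing.Theory Num.Theory.
Import numFieldNormedType.Exports.

Local Open Scope classical_set_scope.
Local Open Scope ring_scope.

Section Processes.
Context d (Omega : measurableType d) (R : realType) (P : probability Omega R).

(* The product rule over the whole family implies it over every subfamily, by
   taking A i := setT for the indices to be dropped. *)
Definition mutually_independent (n : nat) (Y : 'I_n -> Omega -> R) : Prop :=
  forall A : 'I_n -> set R, (forall i, measurable (A i)) ->
    P (\bigcap_(i in [set: 'I_n]) (Y i @^-1` A i)) =
    (\prod_(i < n) P (Y i @^-1` A i))%E.

(* Processes are indexed by all of R; only the times in the relevant interval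
   ([0, +oo[ for B, [0, T[ for X) are ever constrained or used. *)

(* The second parameter of normal_prob is the standard deviation. *)
Definition standard_wiener (B : R -> {RV P >-> R}) : Prop :=
  [/\ {ae P, forall w, B 0 w = 0},
      (forall (n : nat) (t : nat -> R), 0 <= t 0%N ->
        (forall i, (i < n)%N -> t i <= t i.+1) ->
        mutually_independent (fun (i : 'I_n) w => B (t i.+1) w - B (t i) w)),
      (forall s t : R, 0 <= s -> s < t -> forall A : set R, measurable A ->
        P [set w | A (B t w - B s w)] = normal_prob 0 (Num.sqrt (t - s)) A) &
      {ae P, forall w,
        {within [set t : R | 0 <= t], continuous (fun t => B t w)}}].

Definition natural_filtration (B : R -> {RV P >-> R}) (t : R) :
    set (set Omega) :=
  <<s [set E | exists u : R, [/\ 0 <= u, u <= t &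
        exists2 A : set R, measurable A & E = B u @^-1` A]] >>.

(* The P-null events are added to the natural filtration, which is then made
   right-continuous: the smallest filtration satisfying the usual conditions
   to which B is adapted. *)
Definition usual_filtration (B : R -> {RV P >-> R}) (t : R) :
    set (set Omega) :=
  \bigcap_(s in [set s | t < s])
    <<s natural_filtration B s `|` [set N | measurable N /\ P N = 0%E] >>.

(* Strong solution on [0, T[, with continuous paths, of
     dX_t = b(t, X_t) dt + dB_t,  X_0 = 0.
   As the diffusion coefficient is 1 and B_0 = 0, the stochastic integral in
   the integrated equation is B_t itself. *)
Definition strong_solution (B : R -> {RV P >-> R}) (T : R) (b : R -> R -> R)
    (X : R -> {RV P >-> R}) : Prop :=
  [/\ (forall t, 0 <= t < T -> forall A : set R, measurable A ->
        usual_filtration B t (X t @^-1` A)),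
      (forall w,
        {within [set t : R | 0 <= t < T], continuous (fun t => X t w)}),
      {ae P, forall w, X 0 w = 0} &
      {ae P, forall w, forall t, 0 <= t < T ->
        lebesgue_measure.-integrable `[0, t] (fun s => (b s (X s w))%:E) /\
        X t w = \int[lebesgue_measure]_(s in `[0, t]) b s (X s w) + B t w}].

End Processes.

(* Main.v *)
Require Import Defs.
From HB Require Import structures.
From mathcomp Require Import all_boot all_order all_algebra.
From mathcomp Require Import all_classical all_reals all_analysis.
From mathcomp Require Import measurable_realfun zify ring lra.

Import Order.TTheory GRing.Theory Num.Theory.
Import numFieldNormedType.Exports.

Local Open Scope classical_set_scope.
Local Open Scope ring_scope.

Set Implicit Arguments.
Unset Strict Implicit.
Unset Printing Implicit Defensive.


(** Write c(t) = (T - t)^(-alpha) for the integrating factor of the equation.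
    The product rule turns the equation into c(t) X_t = int_0^t c dB, a process
    with independent Gaussian increments, whose variance over [s, t] is
    V(t) - V(s) with V(t) = (T - t)^(1 - 2 alpha) / (2 alpha - 1).  As
    alpha > 1/2, the clock V tends to infinity at T, and the theorem is the law
    of the iterated logarithm for a Brownian motion run with this clock.

    No stochastic integral is constructed and no limit law is identified.  Path
    by path, int c dB is a limit of Riemann-Stieltjes sums
    ([stieltjes_sum_cvg], [strong_solution_path]).  About such a sum only two
    facts are used: its moment generating function, which yields an upper tail
    by Chernoff ([gaussian_mgf_tail]) and a lower tail of nearly the same
    exponential order by tilting ([gaussian_mgf_lower_tail]); and the
    independence of the sums over disjoint blocks ([indep_along_blocks]).  The estimates are
    uniform in the mesh, so Fatou's lemma for events ([ae_near_prob_le])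
    carries them to the limit.  Since c increases, sums with left (right)
    endpoints have variance at most (at least) V(t) - V(s) ([clock_sum]); hence
    the variances need not be shown to converge.

    The times t_j = T - exp(-j r) are geometric in T - t.  For the upper bound
    ([lil_upper]) r is small: the first Borel-Cantelli lemma bounds X at the
    times t_j, and up to the next one X exceeds the positive part of its value at
    t_j by at most twice the oscillation of B ([solution_path_increment]).  That
    oscillation is controlled by a union bound over dyadic increments
    ([brownian_sup_tail]); the constant lost there is compensated by the small
    length of the interval, at most r (T - t_j).
    For the lower bound ([lil_lower]) r is large: the increment of c X over
    [t_j, t_(j+1)] carries almost all of the variance of c X at t_(j+1), these
    increments are independent, and the second Borel-Cantelli lemma applies
    ([increments_io]); what remains, c X at t_j, is bounded below by the upper
    bound for -X, which solves the equation driven by -B.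

    The same symmetry gives the limits inferior.  The second pair of claims
    follows because the normalizer divided by (T - t)^alpha tends to infinity
    ([lil_div_powR_ge]).  Paths being continuous, a limit superior at T is a
    countable expression, so the events are measurable
    ([measurable_limf_esup_left]) and almost sure properties give them
    probability one.                                                         *)

(** * Exponential moments and Gaussian tails *)

Section gaussian.
Context d (Omega : measurableType d) (R : realType) (P : probability Omega R).
Local Notation mu := (@lebesgue_measure R).

Lemma ge0_integral_normal_prob (m s : R) f :
  measurable_fun setT f -> (forall x, 0 <= f x)%E ->
  (\int[normal_prob m s]_x f x = \int[mu]_x (f x * (normal_pdf m s x)%:E))%E.
Proof.
move=> mf f0.
have dom := @normal_prob_dominates R m s.
rewrite -(Radon_Nikodym_SigmaFinite.change_of_variables dom)//.
apply: ae_eq_integral => //.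
- apply: emeasurable_funM => //.
  apply: (measurable_int mu).
  exact: Radon_Nikodym_SigmaFinite.f_integrable.
- apply: emeasurable_funM => //; apply/measurable_EFinP.
  exact: measurable_normal_pdf.
- apply: ae_eqe_mul2l.
  apply: integral_ae_eq => //=.
  + exact: Radon_Nikodym_SigmaFinite.f_integrable.
  + by apply/measurable_EFinP; exact: measurable_normal_pdf.
  + by move=> A _ mA; rewrite -Radon_Nikodym_SigmaFinite.f_integral.
Qed.

(** The centred Gaussian law of variance [v], recorded through its exponential
    moments: these multiply for independent variables, so that sums are handled
    without convolving densities. *)
Definition gaussian_mgf (Y : Omega -> R) (v : R) :=
  measurable_fun setT Y /\
  forall l, (\int[P]_w (expR (l * Y w))%:E = (expR (l ^+ 2 * v / 2))%:E)%E.

(** Completing the square in the exponent shifts the mean of the density to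
    [l * s ^+ 2], and the shifted density still integrates to one. *)
Lemma normal_gaussian_mgf (Y : Omega -> R) (s : R) : s != 0 ->
  measurable_fun setT Y ->
  (forall A, measurable A -> P [set w | A (Y w)] = normal_prob 0 s A) ->
  gaussian_mgf Y (s ^+ 2).
Proof.
move=> s0 mY PY; split => // l.
have mexp : measurable_fun setT (fun y : R => (expR (l * y))%:E).
  by apply/measurable_EFinP/measurableT_comp => //; exact: measurable_funM.
transitivity (\int[normal_prob 0 s]_y (expR (l * y))%:E)%E.
  transitivity (\int[pushforward P (Y : Omega -> measurableTypeR R)]_y
      (expR (l * y))%:E)%E.
    by rewrite ge0_integral_pushforward// => y _; rewrite lee_fin expR_ge0.
  by apply: eq_measure_integral => A mA _; exact: PY.
rewrite ge0_integral_normal_prob//.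
have e (y : R) : expR (l * y) * normal_pdf 0 s y =
    expR (l ^+ 2 * s ^+ 2 / 2) * normal_pdf (l * s ^+ 2) s y.
  rewrite !normal_pdfE//= /normal_fun mulrCA [RHS]mulrCA; congr *%R.
  by rewrite -!expRD; congr expR; field.
under eq_integral do rewrite -EFinM e EFinM.
rewrite ge0_integralZl_EFin//.
- by rewrite integral_normal_pdf mule1.
- by move=> y _; rewrite lee_fin normal_pdf_ge0.
- by apply/measurable_EFinP; exact: measurable_normal_pdf.
Qed.

Lemma le_prob_integral (A : set Omega) (f : Omega -> R) :
  measurable A -> measurable_fun setT f -> (forall w, 0 <= f w) ->
  (forall w, A w -> 1 <= f w) -> (P A <= \int[P]_w (f w)%:E)%E.
Proof.
move=> mA mf f0 f1; rewrite -[A in leLHS]setIT -integral_indic//.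
apply: ge0_le_integral => //.
- by apply/measurable_EFinP; exact: measurable_indic.
- exact/measurable_EFinP.
- move=> w _; rewrite lee_fin indicE.
  by case: (boolP (w \in A)) => [/set_mem/f1//|_]; exact: f0.
Qed.

Lemma measurable_ge (Y : Omega -> R) (x : R) : measurable_fun setT Y ->
  measurable [set w | x <= Y w].
Proof.
move=> mY; rewrite (_ : [set w | _] = Y @^-1` `[x, +oo[).
  by rewrite -[X in measurable X]setTI; exact: mY.
by apply/seteqP; split => w /=; rewrite in_itv/= andbT.
Qed.

Lemma measurable_expRM (Y : Omega -> R) l : measurable_fun setT Y ->
  measurable_fun setT (fun w => expR (l * Y w)).
Proof.
by move=> mY; apply: measurableT_comp => //; exact: measurable_funM.
Qed.

Lemma integral_expRMl (Y : Omega -> R) (v : R) (k l : R) : gaussian_mgf Y v ->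
  0 <= k ->
  (\int[P]_w (k * expR (l * Y w))%:E = (k * expR (l ^+ 2 * v / 2))%:E)%E.
Proof.
move=> [mY EY] k0; under eq_integral do rewrite EFinM.
rewrite ge0_integralZl_EFin//; first by rewrite EY.
by apply/measurable_EFinP; exact: measurable_expRM.
Qed.

(** Chernoff's bound at the optimal exponent [x / v']. *)
Lemma gaussian_mgf_tail (Y : Omega -> R) (v v' x : R) :
  gaussian_mgf Y v -> v <= v' -> 0 < v' -> 0 <= x ->
  (P [set w | (x <= Y w)%R] <= (expR (- (x ^+ 2 / (2 * v'))))%:E)%E.
Proof.
move=> gY vv' v'0 x0; have [mY _] := gY.
pose l := x / v'.
apply: (@le_trans _ _ (\int[P]_w (expR (- (l * x)) * expR (l * Y w))%:E)%E).
  apply: le_prob_integral.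
  - exact: measurable_ge.
  - by apply: measurable_funM => //; exact: measurable_expRM.
  - by move=> w; rewrite mulr_ge0// expR_ge0.
  - move=> w /= xY; rewrite -expRD -[leLHS]expR0 ler_expR.
    by rewrite addrC subr_ge0 ler_wpM2l// divr_ge0// ltW.
rewrite (integral_expRMl l gY) ?expR_ge0// lee_fin -expRD ler_expR.
have -> : - (x ^+ 2 / (2 * v')) = - (l * x) + l ^+ 2 * v' / 2.
  by rewrite /l; field; rewrite gt_eqF.
by rewrite lerD2l ler_wpM2r// ler_wpM2l// sqr_ge0.
Qed.

(** Exponential tilting.  Under the density proportional to exp(l Y), with l s
    slightly above u, the variable Y / s concentrates between u and (1 + 2 e) u:
    the exponential moments at u / s and at (1 + 2 e) u / s show that the parts
    outside that window have a small share of E exp(l Y).  Inside it exp(l Y) is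
    at most exp(l s (1 + 2 e) u), which turns the remaining share into a lower
    bound for the probability of Y >= u s. *)
Lemma gaussian_mgf_lower_tail (Y : Omega -> R) (s e u : R) :
  gaussian_mgf Y (s ^+ 2) -> 0 < s -> 0 < e -> 0 <= u ->
  expR (- ((e * u) ^+ 2 / 2)) <= 4^-1 ->
  ((expR (- (u ^+ 2 / 2 * ((1 + e) * (1 + 3 * e)))) / 2)%:E
    <= P [set w | (u * s <= Y w)%R])%E.
Proof.
move=> gY s0 e0 u0 small; have [mY EY] := gY.
have sn0 : s != 0 by rewrite gt_eqF.
set A := [set w | _].
have mA : measurable A by exact: measurable_ge.
pose l := (1 + e) * u.
pose k1 := expR (e * u ^+ 2).
pose k2 := expR (- (e * (1 + 2 * e) * u ^+ 2)).
pose k3 := expR (l * (1 + 2 * e) * u).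
pose f1 w := k1 * expR (u / s * Y w).
pose f2 w := k2 * expR ((1 + 2 * e) * u / s * Y w).
pose f3 w := k3 * (\1_A w : R).
have mf1 : measurable_fun setT f1.
  by apply: measurable_funM => //; exact: measurable_expRM.
have mf2 : measurable_fun setT f2.
  by apply: measurable_funM => //; exact: measurable_expRM.
have mf3 : measurable_fun setT f3 by apply: measurable_funM.
have f10 w : 0 <= f1 w by rewrite mulr_ge0// expR_ge0.
have f20 w : 0 <= f2 w by rewrite mulr_ge0// expR_ge0.
have f30 w : 0 <= f3 w by rewrite mulr_ge0// expR_ge0.
have eus : 0 <= e * u / s by rewrite divr_ge0 ?mulr_ge0// ltW.
(* the three terms handle y below u, above (1 + 2 e) u, and in between *)
have ptw w : expR (l / s * Y w) <= f1 w + f2 w + f3 w.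
  rewrite /f3 indicE; have [|] := boolP (w \in A).
    move=> _; rewrite mulr1; have [yle|ygt] := leP (Y w) ((1 + 2 * e) * u * s).
      apply: (@le_trans _ _ k3); last by rewrite lerDr addr_ge0.
      rewrite ler_expR /l -!mulrA ler_wpM2l ?ler_wpM2l//; first by lra.
      by rewrite ler_pdivrMl//; lra.
    apply: (@le_trans _ _ (f2 w)); last first.
      by have := f10 w; have : 0 <= k3 := expR_ge0 _; lra.
    rewrite /f2 /k2 -expRD ler_expR.
    rewrite -subr_ge0.
    have -> : - (e * (1 + 2 * e) * u ^+ 2) + (1 + 2 * e) * u / s * Y w -
      l / s * Y w = e * u / s * (Y w - (1 + 2 * e) * u * s).
      by rewrite /l; field.
    by rewrite mulr_ge0// subr_ge0 ltW.
  move=> wA; rewrite mulr0 addr0.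
  have Yu : Y w < u * s.
    by rewrite ltNge; apply/negP => h; move/negP: wA; apply; rewrite inE.
  apply: (@le_trans _ _ (f1 w)); last by rewrite lerDl.
  rewrite /f1 /k1 -expRD ler_expR -subr_ge0.
  have -> : e * u ^+ 2 + u / s * Y w - l / s * Y w = e * u / s * (u * s - Y w).
    by rewrite /l; field.
  by rewrite mulr_ge0// subr_ge0 ltW.
have : (\int[P]_w (expR (l / s * Y w))%:E <=
  \int[P]_w (f1 w)%:E + \int[P]_w (f2 w)%:E + \int[P]_w (f3 w)%:E)%E.
  have F1 w : (0 <= (f1 w)%:E)%E by rewrite lee_fin.
  have F2 w : (0 <= (f2 w)%:E)%E by rewrite lee_fin.
  have F3 w : (0 <= (f3 w)%:E)%E by rewrite lee_fin.
  have M1 : measurable_fun setT (EFin \o f1) by exact/measurable_EFinP.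
  have M2 : measurable_fun setT (EFin \o f2) by exact/measurable_EFinP.
  have M3 : measurable_fun setT (EFin \o f3) by exact/measurable_EFinP.
  have M12 : measurable_fun setT (fun w => (f1 w)%:E + (f2 w)%:E)%E.
    exact: emeasurable_funD.
  rewrite -ge0_integralD// -ge0_integralD//; last first.
    by move=> w _; exact: adde_ge0.
  apply: ge0_le_integral => //.
  - by apply/measurable_EFinP; exact: measurable_expRM.
  - exact: emeasurable_funD.
  - by move=> w _; rewrite -!EFinD lee_fin.
rewrite EY (integral_expRMl _ gY) ?expR_ge0// (integral_expRMl _ gY) ?expR_ge0//.
rewrite (_ : \int[P]_w (f3 w)%:E = k3%:E * P A)%E; last first.
  under eq_integral do rewrite EFinM.
  rewrite ge0_integralZl_EFin ?integral_indic ?setIT ?expR_ge0//.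
  by apply/measurable_EFinP; exact: measurable_indic.
have [p pE] : exists p, P A = p%:E.
  by exists (fine (P A)); rewrite fineK// fin_num_measure.
rewrite pE -EFinM -!EFinD !lee_fin.
pose q := expR (l ^+ 2 / 2).
pose h := expR (- ((e * u) ^+ 2 / 2)).
have -> : (l / s) ^+ 2 * s ^+ 2 / 2 = l ^+ 2 / 2 by field.
rewrite -/q.
have -> : k1 * expR ((u / s) ^+ 2 * s ^+ 2 / 2) = q * h.
  by rewrite /k1 /q /h -!expRD; congr expR; rewrite /l; field.
have -> : k2 * expR (((1 + 2 * e) * u / s) ^+ 2 * s ^+ 2 / 2) = q * h.
  by rewrite /k2 /q /h -!expRD; congr expR; rewrite /l; field.
rewrite -/h in small => ineq.
have q0 : 0 < q by exact: expR_gt0.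
have qk : q / 2 <= k3 * p by nra.
have -> : - (u ^+ 2 / 2 * ((1 + e) * (1 + 3 * e))) =
    l ^+ 2 / 2 - l * (1 + 2 * e) * u by rewrite /l; field.
rewrite expRD expRN -/q -/k3 mulrAC ler_pdivrMr ?expR_gt0//.
by rewrite [p * _]mulrC.
Qed.

Lemma gaussian_mgfZ (Y : Omega -> R) (v c : R) :
  gaussian_mgf Y v -> gaussian_mgf (fun w => c * Y w) (c ^+ 2 * v).
Proof.
move=> [mY EY]; split; first exact: measurable_funM.
move=> l; under eq_integral do rewrite mulrA.
by rewrite EY exprMn mulrA.
Qed.

End gaussian.

(** * Independence of a list of random variables *)

Section independence.
Context d (Omega : measurableType d) (R : realType) (P : probability Omega R).
Local Open Scope ereal_scope.

(** Independence of the members of [s] given the event [E], which has probability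
    [c]: every rectangle, cut by [E], has the product probability.  The recursion
    fixes the constraints one variable at a time, so that two neighbours can be
    merged in the middle of the list without any reindexing. *)
Fixpoint indep_along (s : seq (Omega -> R)) (E : set Omega) (c : \bar R)
    : Prop :=
  if s is Y :: s' then
    measurable_fun setT Y /\
    forall A, measurable A ->
      indep_along s' (E `&` Y @^-1` A) (c * P (Y @^-1` A))
  else P E = c.

Lemma measurable_preimage (Y : Omega -> R) (A : set R) :
  measurable_fun setT Y -> measurable A -> measurable (Y @^-1` A).
Proof. by move=> mY mA; rewrite -[X in measurable X]setTI; exact: mY. Qed.

Lemma indep_along_prob s E c : indep_along s E c -> P E = c.
Proof.
elim: s E c => [//|Y s IH] E c /= [_ /(_ _ measurableT)/IH].
by rewrite preimage_setT setIT probability_setT mule1.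
Qed.

(** Both sides are finite measures of [C], and rectangles generate the product
    sigma-algebra. *)
Lemma eq_measure_rectangles (Y Z : Omega -> R) (E : set Omega) :
  measurable_fun setT Y -> measurable_fun setT Z -> measurable E ->
  (forall A B, measurable A -> measurable B ->
    P (E `&` Y @^-1` A `&` Z @^-1` B) = P E * P (Y @^-1` A `&` Z @^-1` B)) ->
  forall C : set (R * R), measurable C ->
    P (E `&` (fun w => (Y w, Z w)) @^-1` C) =
    P E * P ((fun w => (Y w, Z w)) @^-1` C).
Proof.
move=> mY mZ mE rect.
pose YZ := fun w => (Y w, Z w).
have mYZ : measurable_fun setT YZ by exact: measurable_fun_pair.
have finE : P E \is a fin_num by exact: fin_num_measure.
have E0 : (0 <= fine (P E))%R by exact: fine_ge0.
pose m1 := pushforward (mrestr P mE) YZ.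
pose m2 := pushforward (mscale (NngNum E0) P) YZ.
pose G := [set C | exists2 A : set R, measurable A &
  exists2 B : set R, measurable B & A `*` B = C].
move=> C mC.
suff : m1 C = m2 C.
  have -> : m1 C = P (E `&` YZ @^-1` C).
    by rewrite /m1 /pushforward /mrestr setIC.
  have -> // : m2 C = P E * P (YZ @^-1` C).
  by rewrite -[in RHS](fineK finE).
apply: (measure_unique G (fun=> setT)) => //.
- exact: measurable_prod_measurableType.
- move=> _ _ [A1 mA1 [B1 mB1 <-]] [A2 mA2 [B2 mB2 <-]]; rewrite -setXI.
  by exists (A1 `&` A2); [exact: measurableI|exists (B1 `&` B2) => //; exact: measurableI].
- by move=> _; exists setT => //; exists setT => //; rewrite setXTT.
- by rewrite bigcup_const.
- move=> _ [A mA [B mB <-]].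
  have e : YZ @^-1` (A `*` B) = Y @^-1` A `&` Z @^-1` B by [].
  change (m1 (A `*` B) = m2 (A `*` B)).
  have -> : m2 (A `*` B) = P E * P (YZ @^-1` (A `*` B)).
    by rewrite -[in RHS](fineK finE).
  by rewrite /m1 /pushforward /mrestr e -rect// setIC setIA.
- move=> _; change (m1 setT < +oo).
  by rewrite (_ : m1 _ = P E) ?ltey_eq ?finE// /m1 /pushforward /mrestr setTI.
Qed.

(** The constraint on two consecutive variables is relaxed from rectangles to
    any measurable set of the plane, while the rest of the list stays free. *)
Lemma indep_along_pair s (Y Z : Omega -> R) :
  measurable_fun setT Y -> measurable_fun setT Z ->
  (forall A B, measurable A -> measurable B ->
    P (Y @^-1` A `&` Z @^-1` B) = P (Y @^-1` A) * P (Z @^-1` B)) ->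
  forall E c, measurable E ->
  (forall A B, measurable A -> measurable B ->
    indep_along s (E `&` Y @^-1` A `&` Z @^-1` B)
      (c * P (Y @^-1` A) * P (Z @^-1` B))) ->
  forall C : set (R * R), measurable C ->
    indep_along s (E `&` (fun w => (Y w, Z w)) @^-1` C)
      (c * P ((fun w => (Y w, Z w)) @^-1` C)).
Proof.
move=> mY mZ YZ; elim: s => [|X s IH] E c mE /= H C mC.
  have cE : P E = c.
    have := H _ _ measurableT measurableT.
    by rewrite !preimage_setT !setIT !probability_setT !mule1.
  rewrite -cE eq_measure_rectangles// => A B mA mB.
  by rewrite H// -cE YZ// muleA.
have [mX _] := H _ _ measurableT measurableT.
split => // A mA.
rewrite setIAC muleAC.
apply: IH => //; first by apply: measurableI => //; exact: measurable_preimage.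
move=> A' B' mA' mB'; have [_ /(_ _ mA)] := H _ _ mA' mB'.
rewrite -!setIA [X in _ `&` (_ `&` X)]setIC [X in _ `&` X]setIA.
rewrite [X in _ `&` (X `&` _)]setIC -!setIA.
by rewrite -!muleA [X in _ * (_ * X)]muleC [X in _ * X]muleA [X in _ * (X * _)]muleC -!muleA.
Qed.

(** A constraint on the sum is a constraint on the pair, no longer a rectangle. *)
Lemma indep_alongD s (Y Z : Omega -> R) E c : measurable E ->
  (forall A B, measurable A -> measurable B ->
    P (Y @^-1` A `&` Z @^-1` B) = P (Y @^-1` A) * P (Z @^-1` B)) ->
  indep_along (Y :: Z :: s) E c -> indep_along ((Y \+ Z)%R :: s) E c.
Proof.
move=> mE YZ /= [mY H]; have [mZ _] := H _ measurableT.
have mD : measurable_fun setT (fun x : R * R => (x.1 + x.2)%R).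
  by apply: measurable_funD; [exact: measurable_fst|exact: measurable_snd].
split; first exact: measurable_funD.
move=> A mA.
have := @indep_along_pair s _ _ mY mZ YZ E c mE _ ((fun x : R * R => (x.1 + x.2)%R) @^-1` A).
apply; first by move=> A' B' mA' mB'; have [_] := H _ mA'; apply.
by rewrite -[X in measurable X]setTI; exact: mD.
Qed.

End independence.

(** * Sums of independent Gaussian terms *)

Section sums.
Context d (Omega : measurableType d) (R : realType) (P : probability Omega R).
Local Open Scope ereal_scope.

(** The joint law is the product of the two laws, and the integrand factors. *)
Lemma gaussian_mgfD (Y Z : Omega -> R) (v1 v2 : R) :
  gaussian_mgf P Y v1 -> gaussian_mgf P Z v2 ->
  (forall A B, measurable A -> measurable B ->
    P (Y @^-1` A `&` Z @^-1` B) = P (Y @^-1` A) * P (Z @^-1` B)) ->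
  gaussian_mgf P (Y \+ Z)%R (v1 + v2)%R.
Proof.
move=> [mY EY] [mZ EZ] YZ; split; first exact: measurable_funD.
move=> l.
pose Y' : {RV P >-> R} := HB.pack Y (isMeasurableFun.Build _ _ _ _ Y mY).
pose Z' : {RV P >-> R} := HB.pack Z (isMeasurableFun.Build _ _ _ _ Z mZ).
pose pair := fun w => (Y w, Z w).
have mpair : measurable_fun setT pair by exact: measurable_fun_pair.
pose f (x : R) := (expR (l * x))%:E.
have mf : measurable_fun setT f.
  by apply/measurable_EFinP/measurableT_comp => //; exact: measurable_funM.
have f0 x : 0 <= f x by rewrite lee_fin expR_ge0.
pose g (x : R * R) := f x.1 * f x.2.
have mg : measurable_fun setT g.
  apply: emeasurable_funM; apply: (measurableT_comp mf).
  - exact: measurable_fst.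
  - exact: measurable_snd.
have g0 x : 0 <= g x by exact: mule_ge0.
transitivity (\int[P]_w g (pair w)).
  by apply: eq_integral => w _; rewrite /g /f /= mulrDr expRD EFinM.
transitivity (\int[distribution P Y' \x distribution P Z']_x g x).
  transitivity (\int[pushforward P pair]_x g x).
    by rewrite ge0_integral_pushforward.
  apply: eq_measure_integral => C mC _.
  by symmetry; apply: product_measure_unique.
rewrite fubini_tonelli1//.
rewrite /fubini_F /g /=.
under eq_integral do rewrite ge0_integralZl_EFin//.
rewrite ge0_integralZr//; last exact: integral_ge0.
have -> : \int[distribution P Y']_x f x = (expR (l ^+ 2 * v1 / 2))%:E.
  by rewrite -EY /distribution ge0_integral_pushforward.
have -> : \int[distribution P Z']_x f x = (expR (l ^+ 2 * v2 / 2))%:E.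
  by rewrite -EZ /distribution ge0_integral_pushforward.
by rewrite -EFinM -expRD; congr (expR _)%:E; lra.
Qed.

(** The sum of the [j.+1] terms with indices from [m] on; blocks are never empty. *)
Definition partial_sum (Y : nat -> Omega -> R) (m j : nat) : Omega -> R :=
  fun w => (\sum_(i < j.+1) Y (m + i)%N w)%R.

Lemma partial_sumS Y m j :
  partial_sum Y m j.+1 = (partial_sum Y m j \+ Y (m + j.+1)%N)%R.
Proof. by apply/funext => w; rewrite /partial_sum big_ord_recr. Qed.

(** The initial event is the whole space, hence this is plain mutual independence
    of every finite stretch of the sequence. *)
Definition indep_seq (Y : nat -> Omega -> R) :=
  forall m n, indep_along P (map Y (iota m n)) setT 1.

Lemma indep_along_pairP (Y Z : Omega -> R) s : indep_along P (Y :: Z :: s) setT 1 ->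
  forall A B, measurable A -> measurable B ->
    P (Y @^-1` A `&` Z @^-1` B) = P (Y @^-1` A) * P (Z @^-1` B).
Proof.
move=> [_ H] A B mA mB; have [_ /(_ B mB)/indep_along_prob] := H A mA.
by rewrite setTI mul1e.
Qed.

(** The first block is absorbed term by term.  Each step needs the partial sum to
    be independent of the next term alone, which is the same statement for the
    shortest list. *)
Lemma indep_along_partial_sum Y m j : indep_seq Y -> forall s E c, measurable E ->
  indep_along P (map Y (iota m j.+1) ++ s) E c ->
  indep_along P (partial_sum Y m j :: s) E c.
Proof.
move=> iY; elim: j => [|j IH] s E c mE.
  rewrite (_ : partial_sum Y m 0 = Y m)//.
  by apply/funext => w; rewrite /partial_sum big_ord1 addn0.
rewrite -addn1 iotaD map_cat -catA partial_sumS => H.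
apply: indep_alongD => //; last exact: IH.
apply: (@indep_along_pairP _ _ [::]); apply: IH => //.
by have := iY m j.+2; rewrite -(addn1 j.+1) iotaD map_cat.
Qed.

Lemma gaussian_mgf_partial_sum Y v m j : indep_seq Y ->
  (forall i, gaussian_mgf P (Y i) (v i)) ->
  gaussian_mgf P (partial_sum Y m j) (\sum_(i < j.+1) v (m + i)%N)%R.
Proof.
move=> iY gY; elim: j => [|j IH].
  rewrite big_ord1 addn0 (_ : partial_sum Y m 0 = Y m)//.
  by apply/funext => w; rewrite /partial_sum big_ord1 addn0.
rewrite partial_sumS big_ord_recr; apply: gaussian_mgfD => //.
apply: (@indep_along_pairP _ _ [::]); apply: indep_along_partial_sum => //.
by have := iY m j.+2; rewrite -(addn1 j.+1) iotaD map_cat.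
Qed.

Lemma indep_along_blocks Y N : indep_seq Y -> forall n k E c, measurable E ->
  indep_along P (map Y (iota (k * N.+1) (n * N.+1))) E c ->
  indep_along P (map (fun k => partial_sum Y (k * N.+1) N) (iota k n)) E c.
Proof.
move=> iY; elim=> [//|n IH] k E c mE.
rewrite mulSn iotaD map_cat => /indep_along_partial_sum -/(_ iY mE) [mS H].
split => // A mA; apply: IH; last by rewrite mulSnr; exact: H.
by apply: measurableI => //; exact: measurable_preimage.
Qed.

Lemma indep_along_iotaP (S : nat -> Omega -> R) (A : nat -> set R) :
  (forall i, measurable (A i)) -> forall n m E c,
  indep_along P (map S (iota m n)) E c ->
  P (E `&` [set w | forall i, (m <= i < m + n)%N -> A i (S i w)]) =
  c * \prod_(m <= i < m + n) P (S i @^-1` A i).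
Proof.
move=> mA; elim=> [|n IH] m E c.
  move=> /= <-; rewrite addn0 big_geq// mule1; congr (P _).
  rewrite -[RHS]setIT; congr (_ `&` _); apply/seteqP; split => // w _ i im; exfalso; lia.
move=> [_ /(_ _ (mA m))/IH H]; rewrite big_ltn; last by lia.
rewrite addnS -addSn muleA -H; congr (P _).
apply/seteqP; split => w /=.
  move=> [Ew {}H]; split; first by split => //; apply: H; lia.
  by move=> i mi; apply: H; lia.
move=> [[Ew Am] {}H]; split => // i mi.
have [->//|im] := eqVneq i m; apply: H; lia.
Qed.

Lemma indep_along_iota (S : nat -> Omega -> R) :
  (forall i, measurable_fun setT (S i)) -> forall n m E c,
  (forall A : nat -> set R, (forall i, measurable (A i)) ->
    P (E `&` [set w | forall i, (m <= i < m + n)%N -> A i (S i w)]) =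
    c * \prod_(m <= i < m + n) P (S i @^-1` A i)) ->
  indep_along P (map S (iota m n)) E c.
Proof.
move=> mS; elim=> [|n IH] m E c H /=.
  have := H (fun=> setT) (fun=> measurableT).
  by rewrite addn0 big_geq// mule1 => <-; congr (P _); rewrite -[LHS]setIT;
    congr (_ `&` _); apply/seteqP; split.
split => // A0 mA0; apply: IH => A mA.
have mA' i : measurable (if i == m then A0 else A i) by case: ifP.
have := H _ mA'; rewrite big_ltn; last by lia.
rewrite eqxx muleA addnS addSn.
rewrite (_ : \prod_(m.+1 <= i < (m + n).+1) _ =
    \prod_(m.+1 <= i < (m + n).+1) P (S i @^-1` A i)); last first.
  by apply: eq_big_nat => i mi; rewrite gtn_eqF//; lia.
move=> <-; congr (P _); apply/seteqP; split => w /=.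
  move=> [[Ew Am] {}H]; split => // i mi; case: eqVneq => [->//|im].
  by apply: H; lia.
move=> [Ew {}H]; split; first by split => //; have := H m; rewrite eqxx; apply; lia.
by move=> i mi; have := H i; rewrite gtn_eqF; [apply|]; lia.
Qed.

(** A weight only changes the set that constrains its increment. *)
Lemma weighted_increments_indep (B : R -> Omega -> R) (t c : nat -> R) :
  (forall t, measurable_fun setT (B t)) ->
  (forall i, t i <= t i.+1)%R -> (0 <= t 0%N)%R ->
  (forall (n : nat) (t : nat -> R), (0 <= t 0%N)%R ->
    (forall i, (i < n)%N -> (t i <= t i.+1)%R) ->
    mutually_independent P
      (fun (i : 'I_n) w => B (t i.+1) w - B (t i) w)%R) ->
  indep_seq (fun i w => c i * (B (t i.+1) w - B (t i) w))%R.
Proof.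
move=> mB tS t0 iB m n.
have ti i : (0 <= t i)%R by elim: i => // i; move/le_trans; exact.
have mD i : measurable_fun setT (fun w => (c i * (B (t i.+1) w - B (t i) w))%R).
  by apply: measurable_funM => //; exact: measurable_funB.
apply: indep_along_iota => // A mA; rewrite mul1e setTI.
have := iB n (fun i => t (m + i)%N); rewrite addn0 => /(_ (ti m)).
have H i : (i < n)%N -> (t (m + i)%N <= t (m + i.+1)%N)%R by rewrite addnS.
move=> /(_ H) /(_ (fun i => [set x | A (m + i)%N (c (m + i)%N * x)%R])).
have mA' (i : 'I_n) : measurable [set x | A (m + i)%N (c (m + i)%N * x)%R].
  rewrite (_ : [set x | _] = ( *%R (c (m + i)%N)) @^-1` A (m + i)%N)//.
  by rewrite -[X in measurable X]setTI; apply: measurable_funM.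
move=> /(_ mA') E.
rewrite -[X in \prod_(X <= _ < _) _]add0n big_addn addKn big_mkord.
transitivity (P (\bigcap_(i in [set: 'I_n])
    ((fun w => B (t (m + i.+1)%N) w - B (t (m + i)%N) w)%R @^-1`
       [set x | A (m + i)%N (c (m + i)%N * x)%R]))).
  congr (P _); apply/seteqP; split => w /=.
    by move=> Hw i _ /=; rewrite addnS; apply: Hw; have := ltn_ord i; lia.
  move=> Hw i mi; have im : (i - m < n)%N by lia.
  by have := Hw (Ordinal im) I; rewrite /= addnS subnKC//; lia.
rewrite E; apply: eq_bigr => i _; congr (P _).
by apply/seteqP; split => w /=; rewrite addnS addnC.
Qed.

End sums.

(** * Riemann-Stieltjes sums against the integrating factor *)

Section continuity.
Context (R : realType).

Lemma within_continuous_eps (A : set R) (f : R -> R) x e :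
  {within A, continuous f} -> A x -> 0 < e ->
  exists2 d, 0 < d & forall y, A y -> `|x - y| < d -> `|f x - f y| < e.
Proof.
move=> /subspace_continuousP cf Ax e0.
have /cvgrPdist_lt /(_ e e0) := cf x Ax.
rewrite near_withinE => /nbhs_ballP[d /= d0 H].
by exists d => // y Ay xy; exact: H.
Qed.

(** Heine's theorem, in the form used for Riemann sums. *)
Lemma unif_continuous_segment (f : R -> R) p q e :
  {within `[p, q], continuous f} -> 0 < e ->
  exists2 d, 0 < d & forall x y, p <= x <= q -> p <= y <= q ->
    `|x - y| < d -> `|f x - f y| < e.
Proof.
move=> cf e0.
have /compact_near_coveringP cov := @segment_compact R p q.
(* near-covering form of compactness: [d] is the index that tends to 0 *)
pose Q (d x : R) := forall y, p <= x <= q -> p <= y <= q ->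
  `|x - y| < d -> `|f x - f y| < e.
have : \forall d \near 0^'+, `[p, q]%classic `<=` Q d.
  apply: cov => x /= xpq.
  have e20 : 0 < e / 2 by rewrite divr_gt0.
  have [h h0 H] := within_continuous_eps cf xpq e20.
  have h20 : 0 < h / 2 by rewrite divr_gt0.
  near=> x' d => y x'pq ypq x'y.
  have xx' : `|x - x'| < h / 2 by near: x'; apply: (nbhsx_ballx x _ h20).
  have dh : d < h / 2 by near: d; exact: nbhs_right_lt.
  have H1 : `|f x - f x'| < e / 2.
    by apply: H => //; rewrite (lt_trans xx')// gtr_pMr// invf_lt1// ltr1n.
  have H2 : `|f x - f y| < e / 2.
    apply: H => //; rewrite (le_lt_trans (ler_distD x' _ _))//.
    by rewrite [h]splitr ltrD// (lt_trans x'y).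
  rewrite (le_lt_trans (ler_distD (f x) _ _))// (distrC (f x')).
  by rewrite [e]splitr ltrD.
move=> H; near (0 : R)^'+ => d.
exists d => //.
have HQ : `[p, q]%classic `<=` Q d by near: d.
by move=> x y xpq ypq xy; exact: HQ.
Unshelve. all: by end_near. Qed.


Lemma within_continuous_bounded (f : R -> R) p q :
  p <= q -> {within `[p, q], continuous f} ->
  exists2 M, 0 < M & forall x, p <= x <= q -> `|f x| <= M.
Proof.
move=> pq cf.
have [m1 _ H1] := EVT_max pq cf.
have [m2 _ H2] := EVT_min pq cf.
exists (`|f m1| + `|f m2| + 1) => [|x xpq]; first by rewrite ltr_wpDl ?addr_ge0.
have := H1 x; have := H2 x; rewrite in_itv/= => /(_ xpq) h2 /(_ xpq) h1.
rewrite ler_norml.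
have := ler_norm (f m1); have := ler_norm (- f m2).
rewrite normrN => n2 n1.
have a1 := normr_ge0 (f m1); have a2 := normr_ge0 (f m2).
by apply/andP; split; lra.
Qed.

End continuity.

Section riemann_stieltjes.
Context (R : realType) (T alpha : R).
Local Notation mu := (@lebesgue_measure R).

(** (T - t)^(-alpha), written with [expR] and [ln] so that products of powers become
    sums of exponents. *)
Definition ifactor (t : R) := expR (- alpha * ln (T - t)).

Lemma ifactor_gt0 t : 0 < ifactor t.
Proof. exact: expR_gt0. Qed.

Lemma is_derive_ifactor t : t < T ->
  is_derive t 1 ifactor (alpha / (T - t) * ifactor t).
Proof.
move=> tT; have Tt : 0 < T - t by rewrite subr_gt0.
pose f (s : R) := T - s.
have d1 : is_derive t 1 f (0 - 1).
  exact: (is_deriveB (is_derive_cst T t 1) (is_derive_id t 1)).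
have d2 : is_derive t 1 (@ln R \o f) ((T - t)^-1 * (0 - 1)).
  exact: (@is_derive1_comp _ (@ln R) f t _ _ (is_derive1_ln Tt) d1).
have d3 := is_deriveZ (- alpha) d2.
have d4 := @is_derive1_comp _ (@expR R) (- alpha \*: (@ln R \o f)) t _ _ (is_derive_expR _) d3.
apply: (is_derive_eq d4).
by rewrite /ifactor /= /GRing.scale /= /f; field; rewrite gt_eqF.
Qed.

Lemma continuous_ifactor p q : q < T -> {within `[p, q], continuous ifactor}.
Proof.
move=> qT; apply: derivable_within_continuous => t.
rewrite in_itv/= => /andP[_ tq].
have d := is_derive_ifactor (le_lt_trans tq qT).
exact: ex_derive.
Qed.

Definition node (p q : R) (N i : nat) := p + (q - p) * (i%:R / N.+1%:R).

Lemma node0 p q N : node p q N 0 = p.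
Proof. by rewrite /node mul0r mulr0 addr0. Qed.

Lemma node_last p q N : node p q N N.+1 = q.
Proof. by rewrite /node divff ?pnatr_eq0// mulr1 addrC subrK. Qed.

Lemma nodeS p q N i : node p q N i.+1 = node p q N i + (q - p) / N.+1%:R.
Proof. by rewrite /node -[i.+1%:R]natr1; ring. Qed.

Lemma node_ge p q N i : p <= q -> p <= node p q N i.
Proof. by move=> pq; rewrite /node lerDl mulr_ge0 ?subr_ge0// divr_ge0. Qed.

Lemma node_le p q N i j : p <= q -> (i <= j)%N -> node p q N i <= node p q N j.
Proof.
move=> pq ij; rewrite /node lerD2l ler_wpM2l ?subr_ge0//.
by rewrite ler_pM2r ?invr_gt0 ?ltr0n// ler_nat.
Qed.

Lemma node_le_last p q N i : p <= q -> (i <= N.+1)%N -> node p q N i <= q.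
Proof. by move=> pq iN; rewrite -[leRHS](node_last p q N) node_le. Qed.

(** [k] selects the tags: left endpoints for [k = 0], right endpoints for [k = 1]. *)
Definition stieltjes_sum (k : nat) (b : R -> R) p q N :=
  \sum_(i < N.+1) ifactor (node p q N (i + k)) *
    (b (node p q N i.+1) - b (node p q N i)).

(** Summation by parts path by path.  With A = x - b, the difference between
    the increment of c x over [p, q] and the sum is a sum over the cells of the increments of
    x(tag) c + c(tag) A.  The equations for c and A make the derivative of this
    function alpha / (T - s) (x(tag) c(s) - c(tag) x(s)), which is uniformly small
    when the mesh is. *)
Lemma stieltjes_sum_cvg (k : nat) (b x : R -> R) p q : (k <= 1)%N ->
  p < q -> q < T -> {within `[p, q], continuous x} ->
  {within `[p, q], continuous (x \- b)} ->
  (forall s, s \in `]p, q[%R ->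
    is_derive s 1 (x \- b) (- (alpha / (T - s)) * x s)) ->
  stieltjes_sum k b p q N @[N --> \oo] --> ifactor q * x q - ifactor p * x p.
Proof.
move=> k1 pq qT cx cA dA.
have cc := @continuous_ifactor p q qT.
have [Mx Mx0 HMx] := within_continuous_bounded (ltW pq) cx.
have [Mc Mc0 HMc] := within_continuous_bounded (ltW pq) cc.
pose K := `|alpha| / (T - q).
have Tq : 0 < T - q by rewrite subr_gt0.
have K0 : 0 <= K by rewrite divr_ge0 ?normr_ge0 ?ltW.
apply/cvgrPdist_le => /= e e0.
pose D := K * (Mx + Mc) * (q - p) + 1.
have D0 : 0 < D.
  apply: ltr_wpDl => //; apply: mulr_ge0; last by rewrite subr_ge0 ltW.
  by apply: mulr_ge0 => //; rewrite addr_ge0// ltW.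
pose e' := e / D.
have e'0 : 0 < e' by rewrite divr_gt0.
have kk1 i : (i <= i.+1 - k <= i.+1)%N by move: k1; clear; lia.
have kk2 i : (i <= i + k <= i.+1)%N by move: k1; clear; lia.
have [d1 d10 H1] := unif_continuous_segment cx e'0.
have [d2 d20 H2] := unif_continuous_segment cc e'0.
have dd : 0 < Num.min d1 d2 / (q - p) by rewrite divr_gt0 ?subr_gt0 ?lt_min ?d10.
near=> N.
have mesh : (q - p) / N.+1%:R < Num.min d1 d2.
  rewrite mulrC -ltr_pdivlMr ?subr_gt0//.
  near: N; exact: (near_infty_natSinv_lt (PosNum dd)).
have cell u v Xh Ch : p <= u -> u <= v -> v <= q ->
    (forall s, u <= s <= v -> `|Xh * ifactor s - Ch * x s| <= (Mx + Mc) * e') ->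
    `|Xh * (ifactor v - ifactor u) + Ch * ((x \- b) v - (x \- b) u)|
      <= K * (Mx + Mc) * e' * (v - u).
  move=> pu uv vq Hs.
  pose h s := Xh * ifactor s + Ch * (x \- b) s.
  pose dh s := alpha / (T - s) * (Xh * ifactor s - Ch * x s).
  have dhE s : s \in `]u, v[%R -> is_derive s 1 h (dh s).
    rewrite in_itv/= => /andP[us sv].
    have spq : s \in `]p, q[%R.
      by rewrite in_itv/= (le_lt_trans pu us) (lt_le_trans sv vq).
    have sT : s < T by rewrite (lt_trans _ qT)// (lt_le_trans sv vq).
    apply: (is_derive_eq (is_deriveD (is_deriveZ Xh (is_derive_ifactor sT))
      (is_deriveZ Ch (dA s spq)))).
    by rewrite /dh /GRing.scale /=; ring.
  have ch : {within `[u, v], continuous h}.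
    have sub : `[u, v]%classic `<=` `[p, q]%classic.
      by apply: subset_itv; rewrite bnd_simp.
    have c1 := continuous_subspaceW sub cc.
    have c2 := continuous_subspaceW sub cA.
    move=> s; apply: cvgD; (apply: cvgM; first exact: cvg_cst).
      exact: c1.
    exact: c2.
  have [s suv hE] := MVT_segment uv dhE ch.
  have -> : Xh * (ifactor v - ifactor u) + Ch * ((x \- b) v - (x \- b) u) =
    h v - h u by rewrite /h; ring.
  rewrite hE normrM (ger0_norm (_ : 0 <= v - u)) ?subr_ge0//.
  rewrite ler_wpM2r ?subr_ge0// /dh normrM -mulrA.
  move: suv; rewrite in_itv/= => suv; have /andP[us sv] := suv.
  apply: ler_pM => //; last exact: Hs.
  have sq : s <= q by exact: le_trans vq.
  have sT : 0 < T - s by rewrite subr_gt0 (le_lt_trans sq).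
  rewrite /K normrM normfV (gtr0_norm sT) ler_wpM2l// lef_pV2 ?posrE//.
  by rewrite lerD2l lerN2.
pose g i := ifactor (node p q N i) * x (node p q N i).
have -> : ifactor q * x q - ifactor p * x p - stieltjes_sum k b p q N =
  \sum_(i < N.+1) (x (node p q N (i.+1 - k)) *
     (ifactor (node p q N i.+1) - ifactor (node p q N i)) +
     ifactor (node p q N (i + k)) * ((x \- b) (node p q N i.+1) - (x \- b) (node p q N i))).
  have -> : ifactor q * x q - ifactor p * x p = \sum_(i < N.+1) (g i.+1 - g i).
    rewrite -(big_mkord xpredT (fun i => g i.+1 - g i)) telescope_sumr//.
    by rewrite /g node_last node0.
  rewrite /stieltjes_sum -sumrB; apply: eq_bigr => i _.
  case: k k1 {kk1 kk2} => [|[|//]] _; rewrite /g /= ?(subSS, subn0, addn0, addn1); ring.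
apply: (le_trans (ler_norm_sum _ _ _)).
apply: (@le_trans _ _ (\sum_(i < N.+1) K * (Mx + Mc) * e' * ((q - p) / N.+1%:R))).
  apply: ler_sum => i _.
  have Ni : ((q - p) / N.+1%:R) = node p q N i.+1 - node p q N i.
    by rewrite nodeS addrAC subrr add0r.
  rewrite Ni; apply: cell.
  - exact/node_ge/ltW.
  - exact/node_le/leqnSn/ltW.
  - by apply/node_le_last; [exact: ltW|].
  - move=> s /andP[s1 s2].
    have iN : (i < N.+1)%N by [].
    have sp : p <= s <= q.
      rewrite (le_trans _ s1) ?(node_ge _ _ (ltW pq))//= (le_trans s2)//.
      by apply: node_le_last; [exact: ltW|].
    have close j : (i <= j <= i.+1)%N ->
        p <= node p q N j <= q /\ `|node p q N j - s| < Num.min d1 d2.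
      move=> /andP[ij ji]; split.
        rewrite node_ge ?(ltW pq)//= node_le_last ?(ltW pq)//.
        exact: leq_trans iN.
      apply: le_lt_trans mesh; rewrite Ni ler_norml.
      have := node_le N (ltW pq) ij; have := node_le N (ltW pq) ji.
      by move=> h1 h2; apply/andP; split; lra.
    have [xpq xs] := close (i.+1 - k)%N (kk1 i).
    have [cpq cs] := close (i + k)%N (kk2 i).
    set Xh := x _ in xs *; set Ch := ifactor (node p q N (i + k)).
    have -> : Xh * ifactor s - Ch * x s =
      Xh * (ifactor s - Ch) + Ch * (Xh - x s) by ring.
    rewrite (le_trans (ler_normD _ _))// !normrM mulrDl lerD//.
      apply: ler_pM => //; first exact: HMx.
      apply/ltW; rewrite distrC; apply: H2 => //.
      by move: cs; rewrite lt_min => /andP[].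
    apply: ler_pM => //; first exact: HMc.
    by apply/ltW/H1 => //; move: xs; rewrite lt_min => /andP[].
rewrite sumr_const card_ord -[leLHS]mulr_natr.
rewrite [leLHS](_ : _ = K * (Mx + Mc) * (q - p) * e'); last first.
  by rewrite -!mulrA mulVf ?pnatr_eq0// mulr1 /e'; ring.
rewrite /e' mulrA ler_pdivrMr// [leRHS]mulrC.
by rewrite ler_wpM2r ?(ltW e0)// /D lerDl.
Unshelve. all: by end_near. Qed.

End riemann_stieltjes.

(** * Paths of the equation *)

Section solution_path.
Context (R : realType) (T alpha : R).
Local Notation mu := (@lebesgue_measure R).

Record solution_path (b x : R -> R) : Prop := SolutionPath {
  path_continuous : {within [set t | 0 <= t], continuous b};
  path0 : x 0 = 0;
  path_stieltjes : forall k p q, (k <= 1)%N -> 0 <= p -> p < q -> q < T ->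
    stieltjes_sum T alpha k b p q N @[N --> \oo] -->
      ifactor T alpha q * x q - ifactor T alpha p * x p }.

(** The drift integral is differentiable inside the interval by the fundamental
    theorem of calculus, as the integrand is continuous there. *)
Lemma strong_solution_path (b x : R -> R) :
  {within [set t | 0 <= t], continuous b} ->
  {within [set t | 0 <= t < T], continuous x} ->
  x 0 = 0 ->
  (forall t, 0 <= t < T ->
     mu.-integrable `[0, t] (fun s => (- (alpha / (T - s)) * x s)%:E) /\
     x t = \int[mu]_(s in `[0, t]) (- (alpha / (T - s)) * x s) + b t) ->
  solution_path b x.
Proof.
move=> cb cx x0 eqx; split=> // k p q k1 p0 pq qT.
pose f s := - (alpha / (T - s)) * x s.
pose F t := \int[mu]_(s in `[0, t]) f s.
have xbF t : 0 <= t < T -> (x \- b) t = F t.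
  by move=> /eqx[_ xE]; rewrite /= xE addrK.
have q0 : 0 <= q by rewrite (le_trans p0)// ltW.
have [intf _] := eqx q (introT andP (conj q0 qT)).
have sub : `[p, q]%classic `<=` [set t | 0 <= t < T].
  move=> t /=; rewrite in_itv/= => /andP[pt tq].
  by rewrite (le_trans p0 pt) (le_lt_trans tq qT).
have sub0 : `[p, q]%classic `<=` `[0, q]%classic by apply: subset_itvr.
apply: stieltjes_sum_cvg => //.
- exact: continuous_subspaceW cx.
- have cF : {within `[p, q], continuous F}.
    apply: (continuous_subspaceW sub0).
    exact: (parameterized_integral_continuous q0 intf).
  apply: subspace_eq_continuous cF => t /set_mem /sub tT.
  exact/esym/xbF.
- move=> s; rewrite in_itv/= => /andP[ps sq].
  have s0 : 0 < s by exact: le_lt_trans ps.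
  have sT : s < T by exact: lt_trans qT.
  have cxs : {for s, continuous x}.
    have : {within `]0, T[, continuous x}.
      apply: continuous_subspaceW cx => t /=; rewrite in_itv/= => /andP[t0 tT].
      by rewrite tT ltW.
    rewrite continuous_open_subspace; last exact: interval_open.
    by apply; rewrite inE/= in_itv/= s0.
  have cfs : {for s, continuous f}.
    apply: cvgM => //; apply: cvgN; apply: cvgM; first exact: cvg_cst.
    apply: cvgV; first by rewrite subr_eq0 gt_eqF.
    by apply: cvgB; [exact: cvg_cst|exact: cvg_id].
  have [dF F'] := continuous_FTC1_closed sq intf s0 cfs.
  have isF : is_derive s 1 F (f s).
    by apply: DeriveDef; [exact: dF|rewrite -derive1E; exact: F'].
  apply: (near_eq_is_derive _ isF).
  near=> t; apply/esym/xbF; apply/andP; split; near: t.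
  + by apply: filterS (lt_nbhsr s0) => t /ltW.
  + exact: lt_nbhsl.
Unshelve. all: by end_near. Qed.

End solution_path.

(** * Chaining over dyadic increments *)

Section chaining.
Context (R : realType).

Definition dyadic (p q : R) (j i : nat) := p + (q - p) * (i%:R / 2 ^+ j).

Lemma dyadic_double p q j i : dyadic p q j.+1 i.*2 = dyadic p q j i.
Proof.
rewrite /dyadic -muln2 natrM exprS; congr (_ + _ * _).
by rewrite invfM -mulrA [2 * _]mulrA divff ?mul1r// pnatr_eq0.
Qed.

Lemma dyadicS p q j i : dyadic p q j i.+1 - dyadic p q j i = (q - p) / 2 ^+ j.
Proof. by rewrite /dyadic -[i.+1%:R]natr1; ring. Qed.

Lemma dyadic_itv p q j i : p <= q -> (i <= 2 ^ j)%N -> p <= dyadic p q j i <= q.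
Proof.
move=> pq ij; rewrite /dyadic lerDl mulr_ge0 ?subr_ge0 ?divr_ge0 ?exprn_ge0//=.
rewrite addrC -lerBrDr ler_piMr ?subr_ge0// ler_pdivrMr ?exprn_gt0// mul1r.
by rewrite -natrX ler_nat.
Qed.

(** The dyadic point of odd index at level n + 1 is one step away from a point of
    level n, so one increment per level suffices. *)
Lemma chaining_dyadic (f : R -> R) p q (x : nat -> R) :
  (forall j, 0 <= x j) ->
  (forall j i, (i < 2 ^ j)%N ->
    `|f (dyadic p q j i.+1) - f (dyadic p q j i)| <= x j) ->
  forall n i, (i <= 2 ^ n)%N ->
    `|f (dyadic p q n i) - f p| <= \sum_(j < n.+1) x j.
Proof.
move=> x0 H; elim=> [|n IH] i.
  have d0 : dyadic p q 0 0 = p by rewrite /dyadic mul0r mulr0 addr0.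
  rewrite expn0 big_ord1; case: i => [_|[_|//]].
    by rewrite d0 subrr normr0.
  by have := H 0%N 0%N isT; rewrite d0.
rewrite big_ord_recr/= => i2.
move: (odd_double_half i) i2; move: (odd i) (i./2) => [] m <-; rewrite expnS => i2.
  have h : (m < 2 ^ n)%N by lia.
  have := IH _ (ltnW h); have := H n.+1 m.*2.
  rewrite dyadic_double add1n => /(_ _) h1 h2.
  rewrite addrC (le_trans (ler_distD (f (dyadic p q n m)) _ _))// lerD//.
  by apply: h1; rewrite expnS; lia.
rewrite add0n dyadic_double (le_trans (IH _ _)) ?lerDl//.
by lia.
Qed.

Lemma chaining (f : R -> R) p q (x : nat -> R) S : p < q ->
  {within `[p, q], continuous f} ->
  (forall j, 0 <= x j) -> (forall n, \sum_(j < n) x j <= S) ->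
  (forall j i, (i < 2 ^ j)%N ->
    `|f (dyadic p q j i.+1) - f (dyadic p q j i)| <= x j) ->
  forall t, p <= t <= q -> `|f t - f p| <= S.
Proof.
move=> pq cf x0 xS H t tpq; have /andP[pt tq] := tpq.
have qp0 : 0 < q - p by rewrite subr_gt0.
apply/ler_addgt0Pr => e e0.
have [d d0 Hd] := unif_continuous_segment cf e0.
have dq : 0 < d / (q - p) by rewrite divr_gt0.
have [n dn] : exists n, (2 ^+ n)^-1 < d / (q - p).
  near \oo => n; exists n; rewrite -div1r.
  by near: n; exact: (near_infty_natSinv_expn_lt (PosNum dq)).
pose u := (t - p) / (q - p) * 2 ^+ n.
have u0 : 0 <= u by rewrite mulr_ge0 ?divr_ge0 ?exprn_ge0 ?subr_ge0// ltW.
pose i := Num.trunc u.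
have /andP[iu ui] : i%:R <= u < i.+1%:R := truncn_itv u0.
have i2 : (i <= 2 ^ n)%N.
  rewrite -(ler_nat R) (le_trans iu)// natrX /u ler_piMl ?exprn_ge0//.
  by rewrite ler_pdivrMr// mul1r lerD2r.
have uE : t = p + (q - p) * (u / 2 ^+ n).
  by rewrite /u; field; rewrite expf_eq0 pnatr_eq0 andbF gt_eqF.
have step : `|t - dyadic p q n i| < d.
  have -> : t - dyadic p q n i = (q - p) * ((u - i%:R) / 2 ^+ n).
    by rewrite {1}uE /dyadic; ring.
  rewrite ger0_norm ?mulr_ge0 ?invr_ge0 ?exprn_ge0 ?subr_ge0// ?(ltW pq)//.
  rewrite mulrC -ltr_pdivlMr//; apply: le_lt_trans dn.
  rewrite ler_piMl ?invr_ge0 ?exprn_ge0// lerBlDr.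
  by move: ui; rewrite -natr1 addrC => /ltW.
rewrite (le_trans (ler_distD (f (dyadic p q n i)) _ _))// addrC lerD//.
  apply: le_trans (xS n.+1); exact: chaining_dyadic.
by apply/ltW/Hd => //; rewrite dyadic_itv// ltW.
Unshelve. all: by end_near. Qed.

Lemma expRN2_le : expR (- 2) <= 4^-1 :> R.
Proof.
rewrite expRN lef_pV2 ?posrE ?expR_gt0//.
have e1 : 2 <= expR 1 :> R by have := expR_ge1Dx (1 : R) => ?; lra.
have -> : 2 = 1 + 1 :> R by [].
by rewrite expRD; nra.
Qed.

End chaining.

Section chaining_probability.
Context d (Omega : measurableType d) (R : realType) (P : probability Omega R).
Variable B : R -> Omega -> R.

Lemma gaussian_mgf_abs_tail (Y : Omega -> R) (v x : R) :
  gaussian_mgf P Y v -> 0 < v -> 0 <= x ->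
  (P [set w | (x <= `|Y w|)%R] <= (2 * expR (- (x ^+ 2 / (2 * v))))%:E)%E.
Proof.
move=> gY v0 x0; have gN := gaussian_mgfZ (-1) gY.
rewrite sqrrN expr1n mul1r in gN.
have [mY _] := gY; have [mN _] := gN.
have -> : [set w | x <= `|Y w|] = [set w | x <= Y w] `|` [set w | x <= -1 * Y w].
  apply/seteqP; split => w /=; rewrite mulN1r ler_normr => /orP //.
apply: (le_trans (measureU2 _ _ _)); [exact: measurable_ge|exact: measurable_ge|].
rewrite mulr_natl mulr2n EFinD; apply: leeD.
  exact: gaussian_mgf_tail gY _ _ _.
exact: gaussian_mgf_tail gN _ _ _.
Qed.

(** The thresholds of the levels are geometric of ratio 3/4: they sum to [x], and
    since the variance halves from one level to the next, the tail exponents grow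
    like (9/8)^j, which beats the number 2^j of increments once the exponent at
    level 0 is at least 16. *)
Lemma brownian_sup_tail (p q x : R) :
  (forall s t, 0 <= s -> s < t ->
    gaussian_mgf P (fun w => B t w - B s w) (t - s)) ->
  0 <= p -> p < q -> 0 < x -> 16 <= x ^+ 2 / (32 * (q - p)) ->
  exists E, [/\ measurable E,
    (P E <= (4 * expR (- (x ^+ 2 / (32 * (q - p)))))%:E)%E &
    forall w, ~ E w -> {within [set t | 0 <= t], continuous (B ^~ w)} ->
      forall t, p <= t <= q -> `|B t w - B p w| <= x].
Proof.
move=> gB p0 pq x0; set y := x ^+ 2 / _ => y16.
have qp0 : 0 < q - p by rewrite subr_gt0.
(* the factor 1/4 normalizes the sum of the powers of 3/4 *)
pose xj j := x / 4 * (3 / 4) ^+ j.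
have xj0 j : 0 <= xj j by rewrite mulr_ge0 ?divr_ge0 ?exprn_ge0// ?divr_ge0// ltW.
have sxj n : \sum_(j < n) xj j <= x.
  suff -> : \sum_(j < n) xj j = x * (1 - (3 / 4) ^+ n).
    by rewrite ler_piMr ?ltW// gerBl exprn_ge0// divr_ge0.
  elim: n => [|n IH]; first by rewrite big_ord0 expr0 subrr mulr0.
  by rewrite big_ord_recr/= IH /xj exprS; field.
pose D j i w := B (dyadic p q j i.+1) w - B (dyadic p q j i) w.
pose F j i := [set w | xj j <= `|D j i w|].
have dy0 j i : 0 <= dyadic p q j i.
  by rewrite addr_ge0// mulr_ge0 ?divr_ge0 ?exprn_ge0// ltW.
have vpos j : 0 < (q - p) / 2 ^+ j by rewrite divr_gt0// exprn_gt0.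
have gD j i : gaussian_mgf P (D j i) ((q - p) / 2 ^+ j).
  rewrite -(dyadicS p q j i); apply: gB => //.
  by rewrite -subr_gt0 dyadicS.
have mF j i : measurable (F j i).
  have [mD _] := gD j i.
  by apply: measurable_ge; exact: measurableT_comp.
pose G j := \big[setU/set0]_(i < 2 ^ j) F j i.
have mG j : measurable (G j) by apply: bigsetU_measurable.
have expb j : expR (- (xj j ^+ 2 / (2 * ((q - p) / 2 ^+ j)))) <= expR (- y) * 4^-1 ^+ j.
  have -> : xj j ^+ 2 / (2 * ((q - p) / 2 ^+ j)) = y * (9 / 8) ^+ j.
    have -> : (9 / 8 : R) ^+ j = ((3 / 4) ^+ j) ^+ 2 * 2 ^+ j.
      by rewrite -exprM mulnC exprM -exprMn; congr (_ ^+ _); field.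
    by rewrite /xj /y; field; rewrite gt_eqF// expf_eq0 pnatr_eq0 andbF.
  (* Bernoulli's inequality, so that the exponents grow at least linearly *)
  have bern : 1 + j%:R / 8 <= (9 / 8 : R) ^+ j.
    elim: j => [|j IH]; first by rewrite mul0r addr0 expr0.
    rewrite exprS; have : 0 <= j%:R :> R by [].
    rewrite -natr1; nra.
  apply: (@le_trans _ _ (expR (- y + (- 2) * j%:R))).
    rewrite ler_expR; have : 0 <= j%:R :> R by [].
    nra.
  rewrite expRD ler_pM2l ?expR_gt0// [_ * j%:R]mulrC expRM_natl.
  by rewrite lerXn2r ?nnegrE ?expR_ge0 ?invr_ge0//; exact: expRN2_le.
exists (\bigcup_j G j); split.
- exact: bigcup_measurable.
- have PG j : (P (G j) <= (4 * expR (- y) / (2 ^ j.+1)%:R)%:E)%E.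
    apply: (@le_trans _ _ (\sum_(i < 2 ^ j)
        (2 * expR (- (xj j ^+ 2 / (2 * ((q - p) / 2 ^+ j)))))%:E)%E).
      apply: (@le_trans _ _ (\sum_(i < 2 ^ j) P (F j i))%E).
        by apply: content_subadditive.
      by apply: lee_sum => i _; exact: gaussian_mgf_abs_tail.
    rewrite sumEFin lee_fin sumr_const card_ord -[leLHS]mulr_natl.
    apply: (@le_trans _ _ ((2 ^ j)%:R * (2 * (expR (- y) * 4^-1 ^+ j)))).
      by rewrite ler_wpM2l// ler_wpM2l.
    have -> : (4^-1 : R) ^+ j = (2 ^+ j)^-1 ^+ 2.
      by rewrite -exprVn -exprM mulnC exprM; congr (_ ^+ _); field.
    rewrite !natrX [2 ^+ j.+1]exprS.
    have : (2 : R) ^+ j != 0 by rewrite expf_neq0// pnatr_eq0.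
    move: (2 ^+ j) (expR (- y)) => z e z0.
    by rewrite le_eqVlt; apply/orP; left; apply/eqP; field.
  apply: (@le_trans _ _ (\sum_(j <oo) P (G j))%E).
    by apply: measure_sigma_subadditive => //; exact: bigcup_measurable.
  apply: (@le_trans _ _ (\sum_(j <oo) (4 * expR (- y) / (2 ^ j.+1)%:R)%:E)%E).
    exact: lee_nneseries.
  by apply: epsilon_trick0; rewrite mulr_ge0// expR_ge0.
- move=> w nE cB t tpq.
  apply: (@chaining R (B ^~ w) p q xj x pq _ xj0 sxj _ t tpq).
    apply: continuous_subspaceW cB => s /=; rewrite in_itv/= => /andP[ps _].
    exact: le_trans ps.
  move=> j i ij; rewrite leNgt; apply/negP => h; apply: nE.
  exists j => //; rewrite /G -bigcup_mkord; exists i => //=.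
  exact: ltW.
Qed.

End chaining_probability.

(** * Borel-Cantelli lemmas and series *)

Section borel_cantelli.
Context d (Omega : measurableType d) (R : realType) (P : probability Omega R).

(** Fatou's lemma for events: [A] is almost surely contained in the limit inferior
    of the [F n]. *)
Lemma ae_near_prob_le (A : set Omega) (F : nat -> set Omega) (q : \bar R) :
  measurable A -> (forall n, measurable (F n)) ->
  {ae P, forall w, A w -> \forall n \near \oo, F n w} ->
  (forall n, P (F n) <= q)%E -> (P A <= q)%E.
Proof.
move=> mA mF [N [mN N0 subN]] Fq.
pose G n := \bigcap_(k in [set k | (n <= k)%N]) F k.
have mG n : measurable (G n) by apply: bigcap_measurable => //; exists n => /=.
have ndG : nondecreasing_seq G.
  move=> m n mn; apply/subsetPset => w Gw k /= nk.
  by apply: Gw => /=; exact: leq_trans nk.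
have mUG : measurable (\bigcup_n G n) by exact: bigcup_measurable.
have AG : A `<=` (\bigcup_n G n) `|` N.
  move=> w Aw; have [Nw|nNw] := pselect (N w); first by right.
  left; apply: contra_notP nNw => nG; apply: subN => /= /(_ Aw)[m _ Hm].
  by apply: nG; exists m => // k /= mk; exact: Hm.
apply: (@le_trans _ _ (P ((\bigcup_n G n) `|` N))).
  by apply: le_measure => //; rewrite inE//; exact: measurableU.
apply: (le_trans (measureU2 _ _ _)); [exact: mUG|exact: mN|].
rewrite [X in (_ + X)%E](_ : _ = 0%E) ?adde0; last exact: N0.
have cG : (P \o G) n @[n --> \oo] --> P (\bigcup_n G n).
  exact: nondecreasing_cvg_mu.
suff : (lim ((P \o G) n @[n --> \oo]) <= q)%E by rewrite (cvg_lim _ cG).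
apply: lime_le; first by apply/cvg_ex; eexists; exact: cG.
apply: nearW => n; apply: le_trans (Fq n).
by apply: le_measure; rewrite ?inE// => w; apply => /=.
Qed.

Lemma borel_cantelli_sum (F : nat -> set Omega) (u : nat -> R) (M : R) :
  (forall n, measurable (F n)) -> (forall n, P (F n) <= (u n)%:E)%E ->
  (forall n, \sum_(k < n) u k <= M) ->
  {ae P, forall w, \forall n \near \oo, ~ F n w}.
Proof.
move=> mF Fu uM.
have u0 n : 0 <= u n by rewrite -lee_fin (le_trans _ (Fu n)).
exists (lim_sup_set F); split.
- by apply: bigcapT_measurable => n; exact: bigcup_measurable.
- apply: lim_sup_set_cvg0 => //.
  apply: (@le_lt_trans _ _ M%:E); last by rewrite ltry.
  apply: lime_le; first exact: is_cvg_nneseries.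
  apply: nearW => n; rewrite big_mkord.
  apply: (@le_trans _ _ (\sum_(k < n) (u k)%:E)%E); first by apply: lee_sum => i _; exact: Fu.
  by rewrite sumEFin lee_fin.
- move=> w /= nH n _; apply: contra_notP nH => nE.
  by exists n => // k /= nk Fk; apply: nE; exists k.
Qed.

(** The converse half of the Borel-Cantelli lemma, stated for the complements
    [A k]; independence enters only through the product bound. *)
Lemma borel_cantelli_prod (A : nat -> set Omega) (p : nat -> R) :
  (forall n, measurable (A n)) -> (forall k, p k <= 1) ->
  (forall m n, P [set w | forall k, (m <= k < m + n)%N -> A k w] <=
    (\prod_(m <= k < m + n) (1 - p k))%:E)%E ->
  (forall m M, exists n, M <= \sum_(m <= k < m + n) p k) ->
  {ae P, forall w, forall m, exists2 k, (m <= k)%N & ~ A k w}.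
Proof.
move=> mA p1 HP Hp.
pose N m := \bigcap_(k in [set k | (m <= k)%N]) A k.
have mN m : measurable (N m) by apply: bigcap_measurable => //; exists m => /=.
have PN m : P (N m) = 0%E.
  apply/eqP; rewrite eq_le measure_ge0 andbT; apply/lee_addgt0Pr => e e0.
  rewrite add0e.
  (* then the product is at most exp (ln e) = e *)
  have [n Hn] := Hp m (- ln e).
  apply: (@le_trans _ _ (P [set w | forall k, (m <= k < m + n)%N -> A k w])).
    apply: le_measure; rewrite ?inE//.
      rewrite (_ : [set w | _] = \bigcap_(k in [set k | (m <= k < m + n)%N]) A k) //.
      have [n0|n0] := posnP n; last first.
        by apply: bigcap_measurable => //; exists m => /=; lia.
      rewrite (_ : \bigcap_(k in _) _ = setT) //; apply/seteqP; split => // w _ k /=.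
      by move=> h; exfalso; lia.
    by move=> w Nw k /andP[mk _]; exact: Nw.
  apply: (le_trans (HP m n)); rewrite lee_fin.
  apply: (@le_trans _ _ (\prod_(m <= k < m + n) expR (- p k))).
    rewrite !big_nat; apply: ler_prod => k _; rewrite subr_ge0 p1/=.
    exact: expR_ge1Dx.
  rewrite -expR_sum sumrN -[leRHS](lnK (_ : e \in Num.pos)) ?posrE//.
  by rewrite ler_expR lerNl.
exists (\bigcup_m N m); split.
- exact: bigcup_measurable.
- apply/eqP; rewrite eq_le measure_ge0 andbT.
  apply: (@le_trans _ _ (\sum_(m <oo) P (N m))%E).
    by apply: measure_sigma_subadditive => //; exact: bigcup_measurable.
  by rewrite (eq_eseriesr (g := fun=> 0%E)) ?eseries0.
- move=> w /= nH; apply: contra_notP nH => nE m.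
  apply: contra_notP nE => nk; exists m => // k /= mk.
  by apply: contra_notP nk => nA; exists k.
Qed.

End borel_cantelli.

Section series.
Context (R : realType).

(** The terms are (k + 1)^(-p); they are dominated by the increments of
    k^(1 - p) / (p - 1), which telescope. *)
Lemma riemann_sum_bounded (p : R) : 1 < p ->
  exists M, forall n, \sum_(k < n) expR (- p * ln k.+1%:R) <= M.
Proof.
move=> p1; pose g (k : nat) : R := expR (- (p - 1) * ln k%:R).
have p10 : 0 < p - 1 by rewrite subr_gt0.
have step k : (0 < k)%N -> (p - 1) * expR (- p * ln k.+1%:R) <= g k - g k.+1.
  move=> k0; rewrite /g.
  set a := ln k%:R; set b := ln k.+1%:R.
  have kR : 0 < k%:R :> R by rewrite ltr0n.
  have kS : 0 < k.+1%:R :> R by rewrite ltr0n.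
  have ab : k.+1%:R^-1 <= b - a.
    have h : 1 + (- k.+1%:R^-1) = k%:R / k.+1%:R :> R.
      by rewrite -natr1; field; rewrite natr1 gt_eqF.
    have := @le_ln1Dx R (- k.+1%:R^-1).
    rewrite h ltrN2 invf_lt1// ltr1n ltnS => /(_ k0).
    by rewrite ln_div ?posrE// -/a -/b => ?; rewrite -[leRHS]opprB lerNr.
  have -> : expR (- (p - 1) * a) = expR (- (p - 1) * b) * expR ((p - 1) * (b - a)).
    by rewrite -expRD; congr expR; ring.
  have -> : expR (- p * b) = expR (- (p - 1) * b) * k.+1%:R^-1.
    rewrite -[in RHS](lnK kS) -expRN -expRD -/b; congr expR; ring.
  rewrite mulrCA [leRHS](_ : _ = expR (- (p - 1) * b) * (expR ((p - 1) * (b - a)) - 1)).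
    rewrite ler_pM2l ?expR_gt0//.
    have := expR_ge1Dx ((p - 1) * (b - a)).
    by have := ler_wpM2l (ltW p10) ab => h1 h2; rewrite (le_trans h1)// lerBrDl.
  by ring.
exists (1 + (p - 1)^-1) => n.
case: n => [|n]; first by rewrite big_ord0 addr_ge0// invr_ge0 ltW.
rewrite big_ord_recl/= ln1 mulr0 expR0 lerD2l.
rewrite -[leRHS]mul1r ler_pdivlMr// mulrC mulr_sumr.
apply: (@le_trans _ _ (\sum_(k < n) (g k.+1 - g k.+2))).
  by apply: ler_sum => i _; exact: step.
rewrite -(big_mkord xpredT (fun k => g k.+1 - g k.+2)).
rewrite (eq_bigr (fun k => - g k.+2 - - g k.+1)); last by move=> i _; ring.
rewrite (telescope_sumr (fun k => - g k.+1))// opprK addrC.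
rewrite {1}/g ln1 mulr0 expR0 gerBl; exact: expR_ge0.
Qed.

Lemma harmonic_unbounded (m : nat) (M : R) :
  exists n, M <= \sum_(m <= k < m + n) k.+1%:R^-1.
Proof.
apply: contrapT => /forallNP H; apply: (@dvg_harmonic R).
apply: nondecreasing_is_cvgn.
  by apply/nondecreasing_seqP => n; rewrite /series/= big_nat_recr//= lerDl invr_ge0.
exists (\sum_(0 <= k < m) k.+1%:R^-1 + M) => _ [n _ <-].
have /negP := H n; rewrite -ltNge => /ltW Hn.
apply: (@le_trans _ _ (\sum_(0 <= k < m + n) k.+1%:R^-1)).
  rewrite /series/= [leRHS](big_cat_nat (n := n))//= ?leq_addl// lerDl.
  by apply: sumr_ge0 => i _; rewrite invr_ge0.
by rewrite (big_cat_nat (n := m))//= ?leq_addr// lerD2l.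
Qed.

End series.

(** * Variance clock and oscillation of a path *)

Section variance.
Context (R : realType) (T alpha : R).
Local Notation c := (ifactor T alpha).
Local Notation g := (2 * alpha - 1).

(** (T - t)^(1 - 2 alpha) / (2 alpha - 1), a primitive of c^2. *)
Definition clock (t : R) := expR (- g * ln (T - t)) / g.

(** With y = ln ((T - s) / (T - t)) both inequalities reduce to 1 + x <= exp x, at
    -y and y, and at (2 alpha - 1) y and its opposite. *)
Lemma clock_increment s t : 0 < g -> s < t -> t < T ->
  c s ^+ 2 * (t - s) <= clock t - clock s <= c t ^+ 2 * (t - s).
Proof.
move=> g0 st tT.
have Ts : 0 < T - s by rewrite subr_gt0 (lt_trans st).
have Tt : 0 < T - t by rewrite subr_gt0.
pose L := ln (T - s); pose M := ln (T - t); pose y := L - M.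
have tsE : t - s = expR L - expR M by rewrite !lnK ?posrE//; ring.
have cE u : c u ^+ 2 = expR (- g * ln (T - u)) * expR (- ln (T - u)).
  by rewrite /ifactor expr2 -!expRD; congr expR; ring.
rewrite !cE tsE /clock -/L -/M -mulrBl; apply/andP; split.
  have -> : expR (- g * L) * expR (- L) * (expR L - expR M) =
      expR (- g * L) * (1 - expR (- y)).
    rewrite -mulrA mulrBr -!expRD addNr expR0; congr (_ * (_ - expR _)).
    by rewrite /y; ring.
  have -> : (expR (- g * M) - expR (- g * L)) / g =
      expR (- g * L) * ((expR (g * y) - 1) / g).
    rewrite mulrA mulrBr mulr1 -expRD; congr ((expR _ - _) / _).
    by rewrite /y; ring.
  rewrite ler_pM2l ?expR_gt0//; apply: (@le_trans _ _ y).
    by have := expR_ge1Dx (- y) => ?; lra.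
  rewrite ler_pdivlMr//.
  by have := expR_ge1Dx (g * y) => ?; lra.
have -> : expR (- g * M) * expR (- M) * (expR L - expR M) =
    expR (- g * M) * (expR y - 1).
  rewrite -mulrA mulrBr -!expRD addNr expR0; congr (_ * (expR _ - _)).
  by rewrite /y; ring.
have -> : (expR (- g * M) - expR (- g * L)) / g =
    expR (- g * M) * ((1 - expR (- g * y)) / g).
  rewrite mulrA mulrBr mulr1 -expRD; congr ((_ - expR _) / _).
  by rewrite /y; ring.
rewrite ler_pM2l ?expR_gt0//; apply: (@le_trans _ _ y).
  rewrite ler_pdivrMr//.
  by have := expR_ge1Dx (- g * y) => ?; lra.
by have := expR_ge1Dx y => ?; lra.
Qed.

Lemma clock_gt0 t : 0 < g -> 0 < clock t.
Proof. by move=> g0; rewrite divr_gt0// expR_gt0. Qed.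

Lemma clock_sum p q N : 0 < g -> p < q -> q < T ->
  \sum_(i < N.+1) c (node p q N i) ^+ 2 * (node p q N i.+1 - node p q N i) <=
    clock q - clock p <=
  \sum_(i < N.+1) c (node p q N i.+1) ^+ 2 * (node p q N i.+1 - node p q N i).
Proof.
move=> g0 pq qT.
have -> : clock q - clock p =
    \sum_(i < N.+1) (clock (node p q N i.+1) - clock (node p q N i)).
  rewrite -(big_mkord xpredT (fun i => clock (node p q N i.+1) - clock (node p q N i))).
  by rewrite telescope_sumr// node_last node0.
have H i : (i < N.+1)%N ->
    c (node p q N i) ^+ 2 * (node p q N i.+1 - node p q N i) <=
    clock (node p q N i.+1) - clock (node p q N i) <=
    c (node p q N i.+1) ^+ 2 * (node p q N i.+1 - node p q N i).
  move=> iN; apply: clock_increment => //.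
    by rewrite nodeS ltrDl divr_gt0 ?subr_gt0// ltr0n.
  by apply: le_lt_trans qT; apply: node_le_last => //; exact: ltW.
by apply/andP; split; apply: ler_sum => i _; have /andP[] := H i (ltn_ord i).
Qed.

Lemma ifactor_le s t : 0 <= alpha -> s <= t -> t < T -> c s <= c t.
Proof.
move=> a0 st tT; rewrite ler_expR !mulNr lerN2 ler_wpM2l// ler_ln ?posrE ?subr_gt0//.
  by rewrite lerD2l lerN2.
exact: le_lt_trans tT.
Qed.

(** Summation by parts against nondecreasing weights. *)
Lemma abel_bound (w beta : nat -> R) h n :
  {homo w : i j / (i <= j)%N >-> i <= j} -> beta 0%N = 0 ->
  (forall i, (i <= n.+1)%N -> `|beta i| <= h) ->
  `|\sum_(i < n.+1) w i * (beta i.+1 - beta i) - w n * beta n.+1| <= h * (w n - w 0%N).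
Proof.
move=> wm b0; elim: n => [|n IH] H.
  by rewrite big_ord1 b0 subr0 !subrr mulr0 normr0.
rewrite big_ord_recr/=.
have := IH (fun i h => H i (leqW h)).
set S := \sum_(i < n.+1) _ => IHn.
have -> : S + w n.+1 * (beta n.+2 - beta n.+1) - w n.+1 * beta n.+2 =
  (S - w n * beta n.+1) - (w n.+1 - w n) * beta n.+1 by ring.
have wn : 0 <= w n.+1 - w n by rewrite subr_ge0 wm.
have b1 : `|(w n.+1 - w n) * beta n.+1| <= h * (w n.+1 - w n).
  by rewrite normrM (ger0_norm wn) mulrC ler_wpM2r// H.
rewrite (le_trans (ler_normB _ _))//.
by have := lerD IHn b1 => ?; lra.
Qed.

(** On [p, t] the sums with left tags are at most 2 c(t) h by summation by
    parts, hence so is the increment of c x.  After division by c(t), the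
    term c(p) x(p) / c(t) is at most max (x p) 0, as c(p) <= c(t). *)
Lemma solution_path_increment (b x : R -> R) p t h : 0 <= alpha ->
  solution_path T alpha b x -> 0 <= p -> p <= t -> t < T ->
  (forall s, p <= s <= t -> `|b s - b p| <= h) ->
  x t <= Num.max (x p) 0 + 2 * h.
Proof.
move=> a0 sol p0; rewrite le_eqVlt => /predU1P[<- _ H|pt tT H].
  have h0 : 0 <= h by apply: le_trans (normr_ge0 _) (H p _); rewrite lexx.
  have : x p <= Num.max (x p) 0 by rewrite le_max lexx.
  by move=> ?; lra.
have h0 : 0 <= h by apply: le_trans (normr_ge0 _) (H p _); rewrite lexx ltW.
have bound N : stieltjes_sum T alpha 0 b p t N <= 2 * h * c t.
  (* truncated at the last node, since [c] is monotone only before T *)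
  pose w i := c (node p t N (minn i N.+1)).
  pose beta i := b (node p t N i) - b p.
  have wm : {homo w : i j / (i <= j)%N >-> i <= j}.
    move=> i j ij; apply: ifactor_le => //.
      by apply: node_le; [exact: ltW|lia].
    by apply: le_lt_trans tT; apply: node_le_last; [exact: ltW|lia].
  have b0 : beta 0%N = 0 by rewrite /beta node0 subrr.
  have bh i : (i <= N.+1)%N -> `|beta i| <= h.
    by move=> iN; apply: H; rewrite node_ge ?node_le_last ?(ltW pt).
  have := abel_bound wm b0 bh.
  have -> : \sum_(i < N.+1) w i * (beta i.+1 - beta i) = stieltjes_sum T alpha 0 b p t N.
    apply: eq_bigr => i _; rewrite /w addn0 (minn_idPl _); last exact/ltnW.
    by congr (_ * _); rewrite /beta; ring.
  move=> /(le_trans (ler_norm _)).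
  have wN : w N <= c t.
    rewrite (le_trans (wm _ _ (leqnSn N)))// /w minnn node_last//.
  have w0 i : 0 < w i by exact: expR_gt0.
  have : w N * beta N.+1 <= w N * h.
    by rewrite ler_pM2l// (le_trans (ler_norm _))// bh.
  have := ler_wpM2l h0 wN.
  have := mulr_ge0 h0 (ltW (w0 0%N)).
  move=> ? ? ? ?; lra.
have cv := path_stieltjes sol (leq0n 1) p0 pt tT.
have lim : c t * x t - c p * x p <= 2 * h * c t.
  rewrite -(cvg_lim _ cv)//; apply: limr_le; first by apply/cvg_ex; eexists; exact: cv.
  exact: nearW.
have ct : 0 < c t by exact: expR_gt0.
rewrite -(ler_pM2l ct).
have : c p * x p <= c t * Num.max (x p) 0.
  apply: (@le_trans _ _ (c p * Num.max (x p) 0)).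
    by rewrite ler_pM2l ?expR_gt0// le_max lexx.
  rewrite ler_wpM2r ?le_max ?lexx ?orbT//.
  by apply: ifactor_le => //; exact: ltW.
by move=> ?; lra.
Qed.

End variance.

(** * Tails of the solution and of its increments *)

Section process.
Context d (Omega : measurableType d) (R : realType) (P : probability Omega R).
Variables (T alpha : R).
Local Notation c := (ifactor T alpha).
Local Notation g := (2 * alpha - 1).
Local Notation V := (clock T alpha).

(** The properties of a pair (driving process, solution) on which the bounds rest;
    they are stable under changing the sign of both processes. *)
Record gauss_solution (B X : R -> Omega -> R) : Prop := GaussSolution {
  gs_measB : forall t, measurable_fun setT (B t);
  gs_measX : forall t, measurable_fun setT (X t);
  gs_indep : forall (n : nat) (t : nat -> R), 0 <= t 0%N ->
    (forall i, (i < n)%N -> t i <= t i.+1) ->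
    mutually_independent P (fun (i : 'I_n) w => B (t i.+1) w - B (t i) w);
  gs_mgf : forall s t, 0 <= s -> s < t ->
    gaussian_mgf P (fun w => B t w - B s w) (t - s);
  gs_path : {ae P, forall w, solution_path T alpha (B ^~ w) (X ^~ w)} }.

Lemma solution_pathN (b x : R -> R) : solution_path T alpha b x ->
  solution_path T alpha (fun t => - b t) (fun t => - x t).
Proof.
move=> [cb x0 cv]; split; first by move=> t; apply: cvgN; exact: cb.
  by rewrite x0 oppr0.
move=> k p q k1 p0 pq qT.
have -> : stieltjes_sum T alpha k (fun t => - b t) p q =
    (fun N => - stieltjes_sum T alpha k b p q N).
  apply/funext => N; rewrite /stieltjes_sum -sumrN; apply: eq_bigr => i _.
  by ring.
have -> : c q * - x q - c p * - x p = - (c q * x q - c p * x p) by ring.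
by apply: cvgN; exact: cv.
Qed.

Lemma gauss_solutionN (B X : R -> Omega -> R) : gauss_solution B X ->
  gauss_solution (fun t w => - B t w) (fun t w => - X t w).
Proof.
move=> [mB mX iB gB pX]; split.
- by move=> t; exact: measurableT_comp.
- by move=> t; exact: measurableT_comp.
- move=> n t t0 tS A mA.
  have mN i : measurable [set x : R | A i (- x)].
    have mo : measurable_fun setT (fun x : R => - x) by exact: measurableT_comp.
    by rewrite -[X in measurable X]setTI; exact: mo.
  have e (i : 'I_n) : (fun w => - B (t i.+1) w - - B (t i) w) @^-1` A i =
      (fun w => B (t i.+1) w - B (t i) w) @^-1` [set x | A i (- x)].
    by apply/seteqP; split => w /=; rewrite opprB opprK addrC.
  rewrite (eq_bigcapr (fun i _ => e i)) (iB n t t0 tS _ mN).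
  by apply: eq_bigr => i _; rewrite e.
- move=> s t s0 st; have := gaussian_mgfZ (-1) (gB s t s0 st).
  rewrite sqrrN expr1n mul1r; congr (gaussian_mgf _ _ _); apply/funext => w.
  by ring.
- by apply: filterS pX => w; exact: solution_pathN.
Qed.

Lemma measurable_gt (Y : Omega -> R) (x : R) : measurable_fun setT Y ->
  measurable [set w | x < Y w].
Proof.
move=> mY; rewrite (_ : [set w | _] = ~` [set w | - x <= - 1 * Y w]).
  by apply/measurableC/measurable_ge; exact: measurable_funM.
by apply/seteqP; split => w /=; rewrite mulN1r lerN2 ltNge => /negP.
Qed.

Context (B X : R -> Omega -> R) (sol : gauss_solution B X).

Section grid.
Variables (t : nat -> R) (N : nat).
Hypotheses (t0 : 0 <= t 0%N) (tS : forall k, t k < t k.+1).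

(** Every interval [t k, t k.+1] is cut into [N.+1] equal cells, and all cells are
    enumerated by one index. *)
Definition grid (i : nat) : R :=
  node (t (i %/ N.+1)) (t (i %/ N.+1).+1) N (i %% N.+1).

Lemma gridE k j : (j <= N.+1)%N -> grid (k * N.+1 + j) = node (t k) (t k.+1) N j.
Proof.
rewrite leq_eqVlt => /predU1P[->|jN].
  by rewrite /grid -mulSnr modnMl mulnK// node0 node_last.
by rewrite /grid divnMDl// divn_small// addn0 modnMDl modn_small.
Qed.

Lemma grid_step k j : (j <= N)%N ->
  grid (k * N.+1 + j).+1 - grid (k * N.+1 + j) = (t k.+1 - t k) / N.+1%:R.
Proof.
move=> jN; rewrite -addnS (gridE k (j := j.+1) jN) (gridE k (leqW jN)) nodeS.
by rewrite addrAC subrr add0r.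
Qed.

Lemma grid_lt i : grid i < grid i.+1.
Proof.
have iN : (i %% N.+1 <= N)%N by rewrite -ltnS ltn_mod.
rewrite -subr_gt0 (divn_eq i N.+1) grid_step//.
by rewrite divr_gt0 ?subr_gt0.
Qed.

Lemma grid_ge0 i : 0 <= grid i.
Proof.
have tk k : 0 <= t k by elim: k => // k /le_trans; apply; exact: ltW.
by rewrite /grid (le_trans (tk (i %/ N.+1)%N))// node_ge// ltW.
Qed.

Definition grid_term (k i : nat) : Omega -> R :=
  fun w => c (grid (i + k)) * (B (grid i.+1) w - B (grid i) w).

Lemma grid_term_indep k : indep_seq P (grid_term k).
Proof.
apply: (weighted_increments_indep (fun i => c (grid (i + k)%N)) (gs_measB sol)).
- by move=> i; exact/ltW/grid_lt.
- exact: grid_ge0.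
- exact: gs_indep sol.
Qed.

Lemma grid_term_mgf k i :
  gaussian_mgf P (grid_term k i) (c (grid (i + k)) ^+ 2 * (grid i.+1 - grid i)).
Proof.
by apply: gaussian_mgfZ; apply: (gs_mgf sol); [exact: grid_ge0|exact: grid_lt].
Qed.

Lemma partial_sum_grid_term k m : (k <= 1)%N ->
  partial_sum (grid_term k) (m * N.+1) N =
    (fun w => stieltjes_sum T alpha k (B ^~ w) (t m) (t m.+1) N).
Proof.
move=> k1; apply/funext => w; apply: eq_bigr => i _; rewrite /grid_term.
have iN := ltn_ord i.
have ik : (i + k <= N.+1)%N by move: k1 iN; clear; lia.
by rewrite -addnA -addnS (gridE m ik) (gridE m (j := i.+1) iN) (gridE m (ltnW iN)).
Qed.

Lemma stieltjes_sum_mgf k m : (k <= 1)%N ->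
  gaussian_mgf P (fun w => stieltjes_sum T alpha k (B ^~ w) (t m) (t m.+1) N)
    (\sum_(i < N.+1) c (node (t m) (t m.+1) N (i + k)) ^+ 2 *
       (node (t m) (t m.+1) N i.+1 - node (t m) (t m.+1) N i)).
Proof.
move=> k1; rewrite -partial_sum_grid_term//.
have := gaussian_mgf_partial_sum (m * N.+1) N (grid_term_indep k) (grid_term_mgf k).
rewrite (eq_bigr (fun i : 'I_N.+1 => c (node (t m) (t m.+1) N (i + k)) ^+ 2 *
       (node (t m) (t m.+1) N i.+1 - node (t m) (t m.+1) N i)))//.
move=> i _; have iN := ltn_ord i.
have ik : (i + k <= N.+1)%N by move: k1 iN; clear; lia.
by rewrite -addnA -addnS (gridE m ik) (gridE m (j := i.+1) iN) (gridE m (ltnW iN)).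
Qed.

Lemma stieltjes_sum_indep k (A : nat -> set R) m n : (k <= 1)%N ->
  (forall i, measurable (A i)) ->
  P [set w | forall i, (m <= i < m + n)%N ->
      A i (stieltjes_sum T alpha k (B ^~ w) (t i) (t i.+1) N)] =
  (\prod_(m <= i < m + n)
    P [set w | A i (stieltjes_sum T alpha k (B ^~ w) (t i) (t i.+1) N)])%E.
Proof.
move=> k1 mA.
have iY := grid_term_indep k.
have := indep_along_blocks (N := N) iY measurableT (iY (m * N.+1)%N (n * N.+1)%N).
move=> /(indep_along_iotaP mA); rewrite mul1e setTI => H.
transitivity (P [set w | forall i, (m <= i < m + n)%N ->
    A i (partial_sum (grid_term k) (i * N.+1) N w)]).
  by congr (P _); apply/seteqP; split => w /= h i mi; have := h i mi;
    rewrite partial_sum_grid_term.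
rewrite H; apply: eq_bigr => i _.
by rewrite partial_sum_grid_term.
Qed.

End grid.

Hypothesis g0 : 0 < g.

(** Left tags, whose variance is at most V(t), and c(t)^2 = (2 alpha - 1) V(t) / (T - t). *)
Lemma solution_tail t x : 0 < t -> t < T -> 0 <= x ->
  (P [set w | (x < X t w)%R] <= (expR (- (x ^+ 2 * g / (2 * (T - t)))))%:E)%E.
Proof.
move=> t0 tT x0.
have ct : 0 < c t := ifactor_gt0 _ _ _.
pose tt (k : nat) := t * k%:R.
have tt0 : 0 <= tt 0%N by rewrite /tt mulr0.
have ttS k : tt k < tt k.+1 by rewrite /tt ltr_pM2l// ltr_nat.
pose S N w := stieltjes_sum T alpha 0 (B ^~ w) 0 t N.
have e0 : tt 0%N = 0 by rewrite /tt mulr0.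
have e1 : tt 1%N = t by rewrite /tt mulr1.
have mgfS N : gaussian_mgf P (S N) (\sum_(i < N.+1) c (node 0 t N i) ^+ 2 *
       (node 0 t N i.+1 - node 0 t N i)).
  have := stieltjes_sum_mgf N tt0 ttS 0%N (leq0n 1).
  rewrite e0 e1 (eq_bigr (fun i : 'I_N.+1 => c (node 0 t N i) ^+ 2 *
    (node 0 t N i.+1 - node 0 t N i)))// => i _.
  by rewrite addn0.
apply: (ae_near_prob_le (F := fun N => [set w | c t * x <= S N w])).
- exact/measurable_gt/(gs_measX sol).
- by move=> N; have [mS _] := mgfS N; exact: measurable_ge.
- apply: filterS (gs_path sol) => w sw xX.
  have := path_stieltjes sw (leq0n 1) (lexx 0) t0 tT.
  rewrite (path0 sw) mulr0 subr0 => /cvgrPdist_lt.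
  have e : 0 < c t * (X t w - x) by rewrite mulr_gt0// subr_gt0.
  move=> /(_ _ e); apply: filterS => N; rewrite ltr_norml => /andP[_ h].
  by rewrite /= /S; lra.
- move=> N.
  have Vt : 0 < V t := clock_gt0 _ _ g0.
  have vV : \sum_(i < N.+1) c (node 0 t N i) ^+ 2 *
       (node 0 t N i.+1 - node 0 t N i) <= V t.
    have /andP[h _] := clock_sum N g0 t0 tT.
    by rewrite (le_trans h)// gerBl ltW// clock_gt0.
  apply: (le_trans (gaussian_mgf_tail (mgfS N) vV Vt _)).
    by rewrite mulr_ge0// ltW.
  rewrite lee_fin le_eqVlt; apply/orP; left; apply/eqP; congr (expR (- _)).
  have Tt : 0 < T - t by rewrite subr_gt0.
  have cE : c t ^+ 2 = g * V t / (T - t).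
    have -> : (T - t)^-1 = expR (- ln (T - t)) by rewrite expRN lnK ?posrE.
    rewrite /ifactor /clock mulrCA divff ?gt_eqF// mulr1.
    by rewrite expr2 -!expRD; congr expR; ring.
  rewrite exprMn cE; field.
  by rewrite !gt_eqF.
Qed.

(** Right tags, whose variance is at least V(t k.+1) - V(t k): the threshold in
    units of the actual standard deviation is then at most [u k], so that the
    lower tail holds for every mesh. *)
Lemma increments_io (t u : nat -> R) (e : R) :
  0 <= t 0%N -> (forall k, t k < t k.+1) -> (forall k, t k < T) ->
  0 < e -> (forall k, 0 <= u k) ->
  (forall k, expR (- ((e * u k) ^+ 2 / 2)) <= 4^-1) ->
  (forall m M, exists n, M <= \sum_(m <= k < m + n)
     expR (- (u k ^+ 2 / 2 * ((1 + e) * (1 + 3 * e)))) / 2) ->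
  {ae P, forall w, forall m, exists2 k, (m <= k)%N &
    u k * Num.sqrt (V (t k.+1) - V (t k)) <=
      c (t k.+1) * X (t k.+1) w - c (t k) * X (t k) w}.
Proof.
move=> t0 tS tT e0 u0 small Hsum.
pose p k := expR (- (u k ^+ 2 / 2 * ((1 + e) * (1 + 3 * e)))) / 2.
pose x k := u k * Num.sqrt (V (t k.+1) - V (t k)).
pose D k w := c (t k.+1) * X (t k.+1) w - c (t k) * X (t k) w.
pose S N k w := stieltjes_sum T alpha 1 (B ^~ w) (t k) (t k.+1) N.
have tpos k : 0 <= t k by elim: k => // k /le_trans; apply; exact: ltW.
have mD k : measurable_fun setT (D k).
  by apply: measurable_funB; apply: measurable_funM => //; exact: gs_measX sol _.
have mgfS N k := stieltjes_sum_mgf N t0 tS k (leqnn 1).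
have mS N k : measurable_fun setT (S N k) by have [] := mgfS N k.
have p1 k : p k <= 1.
  have : expR (- (u k ^+ 2 / 2 * ((1 + e) * (1 + 3 * e)))) <= 1.
    rewrite -[leRHS]expR0 ler_expR oppr_le0 mulr_ge0 ?divr_ge0 ?sqr_ge0//.
    by rewrite mulr_ge0//; lra.
  by rewrite /p => ?; lra.
have mlt (Y : Omega -> R) y : measurable_fun setT Y -> measurable [set w | Y w < y].
  move=> mY; rewrite (_ : [set w | _] = ~` [set w | y <= Y w]).
    by apply: measurableC; exact: measurable_ge.
  by apply/seteqP; split => w /=; rewrite ltNge => /negP.
have mall (Y : nat -> Omega -> R) m n : (forall k, measurable_fun setT (Y k)) ->
    measurable [set w | forall k, (m <= k < m + n)%N -> Y k w < x k].
  move=> mY; rewrite (_ : [set w | _] =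
      \bigcap_k [set w | (m <= k < m + n)%N -> Y k w < x k]); last first.
    by apply/seteqP; split => w /= h k; [move=> _; exact: h|exact: h].
  apply: bigcapT_measurable => k.
  have [kmn|kmn] := boolP (m <= k < m + n)%N.
    rewrite (_ : [set w | _] = [set w | Y k w < x k]); first exact: mlt.
    by apply/seteqP; split => w /= h; [exact: h|move=> _].
  rewrite (_ : [set w | _] = setT); first exact: measurableT.
  by apply/seteqP; split.
have PS N k : (P [set w | (S N k w < x k)%R] <= (1 - p k)%:E)%E.
  have := mgfS N k; set v := (X in gaussian_mgf _ _ X) => gv0.
  have vV : V (t k.+1) - V (t k) <= v.
    have /andP[_ /le_trans] := clock_sum N g0 (tS k) (tT k.+1); apply.
    rewrite /v le_eqVlt; apply/orP; left; apply/eqP.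
    rewrite [RHS] (eq_bigr (fun i : 'I_N.+1 => c (node (t k) (t k.+1) N i.+1) ^+ 2 *
       (node (t k) (t k.+1) N i.+1 - node (t k) (t k.+1) N i)))// => i _.
    by rewrite addn1.
  have V0 : 0 < V (t k.+1) - V (t k).
    have /andP[h _] := clock_increment g0 (tS k) (tT k.+1).
    by apply: lt_le_trans h; rewrite mulr_gt0 ?subr_gt0// exprn_gt0// expR_gt0.
  have v0 : 0 < v by exact: lt_le_trans vV.
  have gv : gaussian_mgf P (S N k) (Num.sqrt v ^+ 2) by rewrite sqr_sqrtr// ltW.
  have sv : 0 < Num.sqrt v by rewrite sqrtr_gt0.
  have low := gaussian_mgf_lower_tail gv sv e0 (u0 k) (small k).
  rewrite (_ : [set w | _] = ~` [set w | x k <= S N k w]); last first.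
    by apply/seteqP; split => w /=; rewrite ltNge => /negP.
  rewrite probability_setC; last exact: measurable_ge.
  rewrite EFinB; apply: leeB => //; apply: (le_trans low).
  apply: le_measure; rewrite ?inE; [exact: measurable_ge|exact: measurable_ge|].
  move=> w /=; apply: le_trans.
  by rewrite /x ler_wpM2l// ler_wsqrtr.
apply: filterS (borel_cantelli_prod (A := fun k => [set w | D k w < x k]) (p := p) _ p1 _ Hsum).
- by move=> w /= H m; have [k mk nA] := H m; exists k => //; rewrite leNgt; apply/negP.
- by move=> k; exact: mlt.
move=> m n; apply: (ae_near_prob_le
  (F := fun N => [set w | forall k, (m <= k < m + n)%N -> S N k w < x k])).
- exact: mall.
- by move=> N; exact: mall.
- apply: filterS (gs_path sol) => w sw /= HD.
  have ev k : (m <= k < m + n)%N -> \forall N \near \oo, S N k w < x k.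
    move=> /HD Dk.
    have := path_stieltjes sw (leqnn 1) (tpos k) (tS k) (tT k.+1).
    move=> /cvgrPdist_lt; rewrite -subr_gt0 in Dk => /(_ _ Dk).
    apply: filterS => N; rewrite ltr_norml => /andP[h _].
    by move: h; rewrite -/(D k w) -/(S N k w) => h; lra.
  have : \forall N \near \oo, forall k : 'I_n, S N (m + k)%N w < x (m + k)%N.
    apply: filter_forall => k; apply: ev; rewrite leq_addr ltn_add2l; exact: ltn_ord.
  apply: filterS => N H k /andP[mk km].
  have kn : (k - m < n)%N by move: mk km; clear; lia.
  by have := H (Ordinal kn); rewrite /= subnKC.
- move=> N.
  rewrite (stieltjes_sum_indep N t0 tS (A := fun k => [set y | y < x k]) m n (leqnn 1)); last first.
    move=> i; rewrite (_ : [set y | _] = `]-oo, x i[%classic).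
      exact: measurable_itv.
    by apply/seteqP; split => y /=; rewrite in_itv.
  have fP k : P [set w | S N k w < x k] = (fine (P [set w | S N k w < x k]))%:E.
    by rewrite fineK//; apply: fin_num_measure; exact: mlt.
  rewrite (eq_bigr (fun k => (fine (P [set w | S N k w < x k]))%:E)); last first.
    by move=> k _; exact: fP.
  rewrite prodEFin lee_fin !big_nat; apply: ler_prod => k _.
  rewrite fine_ge0//= -lee_fin -fP; exact: PS.
Qed.

End process.

(** * Iterated logarithm bounds along geometric times *)

Lemma half_lt_ge0 (R : realType) (a : R) : 0 < 2 * a - 1 -> 0 <= a.
Proof. by move=> ?; lra. Qed.

Section sampling.
Context (R : realType) (T alpha : R).
Local Notation g := (2 * alpha - 1).
Hypothesis g0 : 0 < g.

Definition lil t :=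
  Num.sqrt (2 * (T - t) / (2 * alpha - 1) * ln (ln (1 / (T - t)))).

(** Sampling times: T - t is geometric of ratio exp(-r) along them. *)
Definition stime (r : R) (j : nat) := T - expR (- (j%:R * r)).

Lemma exists_natM_ge (M r : R) : 0 < r -> exists2 k, (0 < k)%N & M <= k%:R * r.
Proof.
move=> r0; exists (Num.trunc (`|M| / r)).+1 => //.
have /andP[_ h] := truncn_itv (divr_ge0 (normr_ge0 M) (ltW r0)).
by rewrite (le_trans (ler_norm M))// -ler_pdivrMr// ltW.
Qed.

Lemma stime_lt r j : stime r j < T.
Proof. by rewrite ltrBlDr ltrDl expR_gt0. Qed.

Lemma stimeS_lt r j : 0 < r -> stime r j < stime r j.+1.
Proof.
move=> r0; rewrite ltrD2l ltrN2 ltr_expR ltrN2 ltr_pM2r// ltr_nat//.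
Qed.

Lemma stime_le r i j : 0 < r -> (i <= j)%N -> stime r i <= stime r j.
Proof.
by move=> r0 ij; rewrite lerD2l lerN2 ler_expR lerN2 ler_pM2r// ler_nat.
Qed.

Lemma stime_rem r j : T - stime r j = expR (- (j%:R * r)).
Proof. by rewrite /stime; ring. Qed.

Lemma stime_diff r j : stime r j.+1 - stime r j <= expR (- (j%:R * r)) * r.
Proof.
rewrite (_ : _ - _ = expR (- (j%:R * r)) * (1 - expR (- r))).
  rewrite ler_wpM2l ?expR_ge0//.
  by have := expR_ge1Dx (- r) => ?; lra.
by rewrite mulrBr mulr1 -expRD /stime -natr1 mulrDl mul1r opprD; ring.
Qed.

Lemma lil_stimeE r j : lil (stime r j) =
  Num.sqrt (2 * expR (- (j%:R * r)) / g * ln (j%:R * r)).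
Proof. by rewrite /lil stime_rem div1r -expRN opprK expRK. Qed.

Lemma lil_stime_sqr r j : 0 <= ln (j%:R * r) ->
  lil (stime r j) ^+ 2 = 2 * expR (- (j%:R * r)) / g * ln (j%:R * r).
Proof.
move=> l0; by rewrite lil_stimeE sqr_sqrtr// mulr_ge0// divr_ge0 ?(ltW g0).
Qed.

(** Over one sampling interval T - t varies by the factor exp r at most, and the
    iterated logarithm increases. *)
Lemma lil_stime_le r j t : 0 < r -> 1 <= j%:R * r ->
  stime r j <= t <= stime r j.+1 ->
  lil (stime r j) <= expR (r / 2) * lil t.
Proof.
move=> r0 j1 /andP[jt tj].
have tT : 0 < T - t by rewrite subr_gt0 (le_lt_trans tj)// stime_lt.
have l0 : 0 <= ln (j%:R * r) by rewrite ln_ge0.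
have rem1 : T - t <= expR (- (j%:R * r)) by rewrite -stime_rem lerD2l lerN2.
have rem2 : expR (- (j%:R * r)) <= expR r * (T - t).
  have : expR (- (j.+1%:R * r)) <= T - t by rewrite -stime_rem lerD2l lerN2.
  rewrite -(ler_pM2l (expR_gt0 r)) -expRD; congr (expR _ <= _).
  by rewrite -natr1; ring.
have ll : ln (j%:R * r) <= ln (ln (1 / (T - t))).
  have h : j%:R * r <= ln (1 / (T - t)).
    by rewrite div1r lnV ?posrE// lerNr -ler_expR lnK ?posrE.
  by rewrite ler_ln ?posrE//; lra.
have -> : expR (r / 2) = Num.sqrt (expR r).
  by rewrite [in RHS](splitr r) expRD -expr2 sqrtr_sqr ger0_norm ?expR_ge0.
rewrite lil_stimeE /lil -sqrtrM ?expR_ge0//; apply: ler_wsqrtr.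
have -> : expR r * (2 * (T - t) / g * ln (ln (1 / (T - t)))) =
  2 * (expR r * (T - t)) / g * ln (ln (1 / (T - t))) by ring.
apply: ler_pM => //.
  by rewrite divr_ge0 ?(ltW g0)// mulr_ge0// expR_ge0.
by rewrite ler_pM2r ?invr_gt0// ler_pM2l.
Qed.

Lemma stime_bracket r k t : 0 < r -> stime r k <= t -> t < T ->
  exists2 j, (k <= j)%N & stime r j <= t <= stime r j.+1.
Proof.
move=> r0 kt tT; have Tt : 0 < T - t by rewrite subr_gt0.
pose y := - ln (T - t) / r.
have tE : t = T - expR (- (y * r)).
  by rewrite /y divfK ?gt_eqF// opprK lnK ?posrE//; ring.
have ky : k%:R <= y.
  move: kt; rewrite [in X in X -> _]tE /stime lerD2l lerN2 ler_expR lerN2.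
  by rewrite ler_pM2r.
have /andP[y1 y2] := truncn_itv (le_trans (ler0n _ k) ky).
exists (Num.trunc y).
  by rewrite -ltnS -(ltr_nat R) (le_lt_trans ky).
by rewrite tE /stime !lerD2l !lerN2 !ler_expR !lerN2 !ler_pM2r// y1 ltW.
Qed.

End sampling.

Section lil_bounds.
Context d (Omega : measurableType d) (R : realType) (P : probability Omega R).
Variables (T alpha : R).
Local Notation c := (ifactor T alpha).
Local Notation g := (2 * alpha - 1).
Local Notation V := (clock T alpha).
Local Notation lil := (lil T alpha).
Hypotheses (g0 : 0 < g) (T0 : 0 < T).

Lemma exists_start (M r : R) : 0 < r ->
  exists k, [/\ (0 < k)%N, M <= k%:R * r & 0 < stime T r k].
Proof.
move=> r0; have [k k0 kM] := exists_natM_ge (Num.max M (1 - ln T)) r0.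
move: kM; rewrite ge_max => /andP[kM kT]; exists k; split => //.
rewrite subr_gt0 -[ltRHS](lnK (_ : T \in Num.pos)) ?posrE// ltr_expR.
by lra.
Qed.

(** The bad events are a large value at a sampling time and a large oscillation
    of B up to the next one.  Both have probability at most a multiple of
    (j r)^(-(1 + e)): for the oscillation this requires r <= e^2 / (32 (2 alpha - 1)).
    The other constraint on r keeps the normalizer within a factor 1 + e over a
    sampling interval. *)
Lemma lil_upper (B X : R -> Omega -> R) (e : R) :
  gauss_solution P T alpha B X -> 0 < e -> e < 1 ->
  {ae P, forall w, \forall t \near T^'-, X t w <= (1 + 7 * e) * lil t}.
Proof.
move=> sol e0 e1.
pose r := Num.min (e ^+ 2 / (32 * g)) (2 * ln (1 + e)).
have r0 : 0 < r.
  by rewrite lt_min divr_gt0 ?exprn_gt0 ?mulr_gt0//= ln_gt0// ltrDl.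
have r1 : r <= e ^+ 2 / (32 * g) by rewrite ge_min lexx.
have r2 : expR (r / 2) <= 1 + e.
  rewrite -[leRHS]lnK ?posrE ?addr_gt0// ler_expR ler_pdivrMr// mulrC.
  by rewrite ge_min lexx orbT.
(* 8 makes the exponent 2 l k of the oscillation reach the 16 of [brownian_sup_tail] *)
have [k0 [k00 k0M sk0]] := exists_start (expR 8) r0.
pose tau k := stime T r (k + k0).
have jr k : expR 8 <= (k + k0)%:R * r.
  by rewrite (le_trans k0M)// ler_pM2r// ler_nat leq_addl.
have jr0 k : 0 < (k + k0)%:R * r by rewrite (lt_le_trans _ (jr k))// expR_gt0.
pose l k := ln ((k + k0)%:R * r).
have l8 k : 8 <= l k by rewrite -[leLHS]expRK ler_ln ?posrE ?expR_gt0.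
have l0 k : 0 <= l k by rewrite (le_trans _ (l8 k)).
have lil2 k : lil (tau k) ^+ 2 = 2 * expR (- ((k + k0)%:R * r)) / g * l k.
  by rewrite lil_stime_sqr//; exact: l0.
have lilge0 t : 0 <= lil t by exact: sqrtr_ge0.
have lil0 k : 0 < lil (tau k).
  rewrite lt_neqAle lilge0 andbT eq_sym -sqrf_eq0 lil2 gt_eqF//.
  by rewrite mulr_gt0 ?divr_gt0 ?mulr_gt0 ?expR_gt0// (lt_le_trans _ (l8 k)).
have tau0 k : 0 < tau k by rewrite (lt_le_trans sk0)// stime_le// leq_addl.
have tauT k : tau k < T by exact: stime_lt.
have tauS k : tau k < tau k.+1 by rewrite /tau addSn stimeS_lt.
pose q k := expR (- (1 + e) * l k).
have e1l k : - (1 + e) * l k <= 0 by rewrite mulNr oppr_le0 mulr_ge0// addr_ge0// ltW.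
have Fp k : (P [set w | ((1 + e) * lil (tau k) < X (tau k) w)%R] <= (q k)%:E)%E.
  apply: le_trans (solution_tail sol g0 (tau0 k) (tauT k) _) _.
    by rewrite mulr_ge0// addr_ge0// ltW.
  rewrite lee_fin ler_expR mulNr lerN2 exprMn lil2 stime_rem.
  have -> : (1 + e) ^+ 2 * (2 * expR (- ((k + k0)%:R * r)) / g * l k) * g /
      (2 * expR (- ((k + k0)%:R * r))) = (1 + e) ^+ 2 * l k.
    by field; rewrite !gt_eqF ?expR_gt0.
  by rewrite ler_wpM2r//; nra.
have /choice[E HE] : forall k, exists E, [/\ measurable E,
    (P E <= (4 * q k)%:E)%E &
    forall w, ~ E w -> {within [set t | 0 <= t], continuous (B ^~ w)} ->
      forall t, tau k <= t <= tau k.+1 -> `|B t w - B (tau k) w| <= e * lil (tau k)].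
  move=> k.
  have x0 : 0 < e * lil (tau k) by rewrite mulr_gt0.
  have dif0 : 0 < tau k.+1 - tau k by rewrite subr_gt0.
  have y2 : 2 * l k <= (e * lil (tau k)) ^+ 2 / (32 * (tau k.+1 - tau k)).
    rewrite ler_pdivlMr ?mulr_gt0// exprMn lil2.
    have h : tau k.+1 - tau k <= expR (- ((k + k0)%:R * r)) * (e ^+ 2 / (32 * g)).
      rewrite (le_trans (stime_diff _ _ _))// ler_pM2l ?expR_gt0//.
    apply: (@le_trans _ _ (2 * l k * (32 * (expR (- ((k + k0)%:R * r)) * (e ^+ 2 / (32 * g)))))).
      by rewrite ler_wpM2l ?mulr_ge0// ler_pM2l.
    by rewrite le_eqVlt; apply/orP; left; apply/eqP; field; rewrite gt_eqF.
  have y16 : 16 <= (e * lil (tau k)) ^+ 2 / (32 * (tau k.+1 - tau k)).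
    by apply: le_trans y2; have := l8 k => ?; lra.
  have [E [mE PE HE]] := brownian_sup_tail (gs_mgf sol) (ltW (tau0 k)) (tauS k) x0 y16.
  exists E; split => //; apply: (le_trans PE).
  rewrite lee_fin ler_pM2l// ler_expR mulNr lerN2.
  apply: le_trans y2; rewrite ler_wpM2r//; lra.
pose F k := [set w | (1 + e) * lil (tau k) < X (tau k) w] `|` E k.
have mF k : measurable (F k).
  apply: measurableU; last by have [] := HE k.
  exact/measurable_gt/(gs_measX sol).
have PF k : (P (F k) <= (5 * q k)%:E)%E.
  have [mE PE _] := HE k.
  apply: (le_trans (measureU2 _ _ _)); [exact/measurable_gt/(gs_measX sol)|exact: mE|].
  rewrite (_ : 5 * q k = q k + 4 * q k); last by ring.
  by rewrite EFinD; apply: leeD; [exact: Fp|exact: PE].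
have e11 : 1 < 1 + e by rewrite ltrDl.
have [M HM] := riemann_sum_bounded e11.
have sq n : \sum_(k < n) 5 * q k <= 5 * expR (- (1 + e) * ln r) * M.
  apply: (@le_trans _ _ (\sum_(k < n) 5 * expR (- (1 + e) * ln r) * expR (- (1 + e) * ln k.+1%:R))).
    apply: ler_sum => k _; rewrite -mulrA ler_pM2l// -expRD ler_expR -mulrDr.
    rewrite !mulNr lerN2 ler_pM2l ?addr_gt0// /l lnM ?posrE ?ltr0n ?addn_gt0 ?k00 ?orbT//.
    rewrite addrC lerD2r ler_ln ?posrE ?ltr0n ?addn_gt0 ?k00 ?orbT//.
    by rewrite ler_nat -addn1 leq_add2l.
  by rewrite -mulr_sumr ler_pM2l// mulr_gt0// expR_gt0.
have := borel_cantelli_sum mF PF sq.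
apply: filterS2 (gs_path sol) => w sw [K _ HK].
near=> t.
have tT : t < T by near: t; exact: nbhs_left_lt.
have tK : stime T r (K + k0) <= t.
  by near: t; apply: nbhs_left_ge; exact: stime_lt.
have [j Kj jt] := stime_bracket r0 tK tT.
have [k kK jE] : exists2 k, (K <= k)%N & j = (k + k0)%N.
  by exists (j - k0)%N; move: Kj; clear; lia.
rewrite jE -addSn in jt.
have /not_orP[nX nE] := HK k kK.
have Xk : Num.max (X (tau k) w) 0 <= (1 + e) * lil (tau k).
  rewrite ge_max mulr_ge0 ?addr_ge0 ?(ltW e0)// andbT leNgt; exact/negP.
have [_ _ /(_ w nE (path_continuous sw)) Bk] := HE k.
have /andP[kt tk] := jt.
have a0 : 0 <= alpha := half_lt_ge0 g0.
have := solution_path_increment a0 sw (ltW (tau0 k)) kt tT (h := e * lil (tau k)).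
move=> /(_ _) XX.
have {}XX : X t w <= Num.max (X (tau k) w) 0 + 2 * (e * lil (tau k)).
  apply: XX => s /andP[ks st]; apply: Bk; rewrite ks/=.
  exact: le_trans tk.
have j1 : 1 <= (k + k0)%:R * r.
  by rewrite (le_trans _ (jr k))// -[leLHS]expR0 ler_expR.
have lk : lil (tau k) <= (1 + e) * lil t.
  have := lil_stime_le g0 r0 j1 jt.
  by move/le_trans; apply; rewrite ler_wpM2r.
have := lilge0 t; have := lil0 k.
move=> h1 h2.
apply: (@le_trans _ _ ((1 + 3 * e) * lil (tau k))); first by lra.
apply: (@le_trans _ _ ((1 + 3 * e) * ((1 + e) * lil t))).
  by rewrite ler_wpM2l//; lra.
by rewrite mulrA ler_wpM2r//; nra.
Unshelve. all: by end_near. Qed.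

Lemma stime_gt r a : 0 < r -> a < T -> exists m, forall k, (m <= k)%N -> a < stime T r k.
Proof.
move=> r0 aT; have [m _ mM] := exists_natM_ge (1 - ln (T - a)) r0.
exists m => k mk; rewrite (lt_le_trans _ (stime_le T r0 mk))//.
rewrite /stime ltrBrDl -ltrBrDr -[ltRHS](lnK (_ : T - a \in Num.pos)) ?posrE ?subr_gt0//.
by rewrite ltr_expR; lra.
Qed.

(** Relative to the normalizer, the independent increment reaches
    sqrt (th (1 - y^2)) infinitely often, where y = exp (- (2 alpha - 1) r / 2) and
    th = 1 / ((1 + e) (1 + 3 e)) makes the lower bounds for the probabilities
    multiples of 1 / (j r), whose series diverges.  The contribution of the previous time is at
    least -2 y.  Choosing y = h / 6 and e = h / 12 leaves 1 - h. *)
Lemma lil_lower (B X : R -> Omega -> R) (h : R) :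
  gauss_solution P T alpha B X -> 0 < h -> h < 1 ->
  {ae P, forall w, forall a, a < T ->
    exists2 t, a < t < T & (1 - h) * lil t <= X t w}.
Proof.
move=> sol h0 h1.
pose e := h / 12.
have e0 : 0 < e by rewrite divr_gt0.
pose D := (1 + e) * (1 + 3 * e).
have D0 : 0 < D by rewrite mulr_gt0 ?addr_gt0 ?mulr_gt0.
have D1 : 1 <= D by rewrite /D; nra.
pose th := D^-1.
have th0 : 0 < th by rewrite invr_gt0.
have th1 : th <= 1 by rewrite invf_le1.
have the : 1 - 6 * e <= th.
  by rewrite -[leRHS]mul1r ler_pdivlMr// /D; nra.
pose r := - 2 * ln (h / 6) / g.
have h6 : 0 < h / 6 by rewrite divr_gt0.
have r0 : 0 < r by rewrite divr_gt0// nmulr_rgt0 ?ltrN10// ?ln_lt0 ?h6//=; lra.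
pose y := h / 6.
have yE : expR (- (g * r / 2)) = y.
  rewrite -[RHS]lnK ?posrE//; congr expR; rewrite /r /y; field.
  by rewrite gt_eqF.
(* so that (e u)^2 / 2 >= 2 and exp (-2) <= 1/4 *)
have [k0 [k00 k0M sk0]] := exists_start (expR (2 / (e ^+ 2 * th))) r0.
pose tau k := stime T r (k + k0).
have jr k : expR (2 / (e ^+ 2 * th)) <= (k + k0)%:R * r.
  by rewrite (le_trans k0M)// ler_pM2r// ler_nat leq_addl.
have jr0 k : 0 < (k + k0)%:R * r by rewrite (lt_le_trans _ (jr k))// expR_gt0.
pose l k := ln ((k + k0)%:R * r).
have lM k : 2 / (e ^+ 2 * th) <= l k.
  by rewrite -[leLHS]expRK ler_ln ?posrE ?expR_gt0.
have eth0 : 0 < e ^+ 2 * th by rewrite mulr_gt0// exprn_gt0.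
have l0 k : 0 <= l k by rewrite (le_trans _ (lM k))// divr_ge0// ltW.
have tau0 k : 0 < tau k by rewrite (lt_le_trans sk0)// stime_le// leq_addl.
have tauT k : tau k < T by exact: stime_lt.
have tauS k : tau k < tau k.+1 by rewrite /tau addSn stimeS_lt.
pose u k := Num.sqrt (2 * th * l k.+1).
have u2 k : u k ^+ 2 = 2 * th * l k.+1.
  by rewrite sqr_sqrtr// mulr_ge0// mulr_ge0// ltW.
have u0 k : 0 <= u k by exact: sqrtr_ge0.
have small k : expR (- ((e * u k) ^+ 2 / 2)) <= 4^-1.
  apply: (le_trans _ (expRN2_le R)); rewrite ler_expR lerN2 exprMn u2.
  rewrite (_ : _ / 2 = l k.+1 * (e ^+ 2 * th)); last by field.
  by rewrite -ler_pdivrMr.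
have term k : expR (- (u k ^+ 2 / 2 * ((1 + e) * (1 + 3 * e)))) / 2 =
    ((k.+1 + k0)%:R * r)^-1 / 2.
  congr (_ / 2); rewrite u2 -/D (_ : _ / 2 * D = l k.+1).
    by rewrite expRN lnK ?posrE.
  by rewrite /th; field; rewrite gt_eqF.
pose C := (2 * (k0.+1)%:R * r)^-1.
have C0 : 0 < C by rewrite invr_gt0 mulr_gt0// mulr_gt0// ltr0n.
have Hsum m M : exists n, M <= \sum_(m <= k < m + n)
    expR (- (u k ^+ 2 / 2 * ((1 + e) * (1 + 3 * e)))) / 2.
  have [n Hn] := harmonic_unbounded m (M / C); exists n.
  move: Hn; rewrite ler_pdivrMr// => /le_trans; apply.
  rewrite mulr_suml; apply: ler_sum => k _; rewrite term /C.
  have p1 : 0 < (k.+1 + k0)%:R * r * 2 by rewrite mulr_gt0.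
  have p2 : 0 < k.+1%:R * (2 * k0.+1%:R * r) :> R
    by apply: mulr_gt0 => //; apply: mulr_gt0 => //; apply: mulr_gt0.
  rewrite -!invfM lef_pV2 ?posrE//.
  rewrite [leRHS](_ : _ = (k.+1 * k0.+1)%:R * r * 2); last by rewrite natrM; ring.
  rewrite ler_pM2r// ler_pM2r// ler_nat.
  by clear; nia.
have io := increments_io sol g0 (ltW (tau0 0%N)) tauS tauT e0 u0 small Hsum.
have e7 : 0 < 7^-1 :> R by [].
have e71 : 7^-1 < 1 :> R by rewrite invf_lt1// ltr1n.
(* a margin of 1/7 bounds -X by twice the normalizer *)
have up := lil_upper (gauss_solutionN sol) e7 e71.
apply: filterS2 io up => w Hio Hup a aT.
have [a' a'T Ha'] : exists2 a', a' < T & forall t, a' < t < T -> - X t w <= 2 * lil t.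
  case: Hup => dl /= dl0 Hdl; exists (T - dl); first by rewrite gtrBl.
  move=> t /andP[tdl tT].
  have := Hdl t; rewrite /= gtr0_norm ?subr_gt0// => /(_ _ tT).
  rewrite (_ : 1 + 7 * 7^-1 = 2); last by field.
  by apply; rewrite ltrBlDr -ltrBlDl.
have aaT : Num.max a a' < T by rewrite gt_max aT.
have [m Hm] := stime_gt r0 aaT.
have [k mk Hk] := Hio m.
have /Hm : (m <= k + k0)%N by rewrite (leq_trans mk)// leq_addr.
rewrite gt_max => /andP[atau a'tau].
exists (tau k.+1); first by rewrite (lt_trans atau (tauS k)) tauT.
have Xk : - X (tau k) w <= 2 * lil (tau k) by apply: Ha'; rewrite a'tau tauT.
have lk : lil (tau k) <= expR (r / 2) * lil (tau k.+1).
  apply: (lil_stime_le g0 r0).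
    rewrite (le_trans _ (jr k))// -[leLHS]expR0 ler_expR divr_ge0// ltW//.
  by rewrite (ltW (tauS k)) lexx.
have remE j : ln (T - tau j) = - ((j + k0)%:R * r) by rewrite stime_rem expRK.
pose s := th * (1 - y ^+ 2).
have y0 : 0 < y by [].
have y1 : y < 1 by rewrite ltr_pdivrMr// mul1r (lt_trans h1)// ltr1n.
have y2E : y ^+ 2 = expR (- (g * r)).
  by rewrite -yE expr2 -expRD; congr expR; field.
have s0 : 0 <= s by rewrite mulr_ge0 ?(ltW th0)// subr_ge0 expr_le1// ltW.
have s1 : s <= 1.
  rewrite mulr_ile1 ?(ltW th0)//; last by rewrite gerBl sqr_ge0.
  by rewrite subr_ge0 expr_le1// ltW.
have uV : u k * Num.sqrt (V (tau k.+1) - V (tau k)) =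
    c (tau k.+1) * (Num.sqrt s * lil (tau k.+1)).
  have c0 : 0 < c (tau k.+1) := ifactor_gt0 _ _ _.
  rewrite -[c (tau k.+1)]gtr0_norm// -sqrtr_sqr lil_stimeE -!sqrtrM ?sqr_ge0//; last first.
    by rewrite mulr_ge0// mulr_ge0// ltW.
  congr Num.sqrt; rewrite -/(l k.+1).
  have -> : V (tau k.+1) - V (tau k) = expR (g * ((k.+1 + k0)%:R * r)) * (1 - y ^+ 2) / g.
    rewrite /clock !remE -mulrBl y2E mulrBr mulr1 -expRD !mulrNN.
    congr ((_ - expR _) / _); rewrite addSn -[(k + k0).+1%:R]natr1; ring.
  have -> : c (tau k.+1) ^+ 2 = expR (g * ((k.+1 + k0)%:R * r)) * expR ((k.+1 + k0)%:R * r).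
    by rewrite /ifactor remE expr2 -!expRD; congr expR; ring.
  rewrite /s expRN; field.
  by rewrite !gt_eqF ?expR_gt0.
rewrite uV in Hk.
have c0 : 0 < c (tau k.+1) := ifactor_gt0 _ _ _.
have cc : c (tau k) = c (tau k.+1) * expR (- (alpha * r)).
  rewrite /ifactor !remE -expRD; congr expR.
  by rewrite addSn -[(k + k0).+1%:R]natr1; ring.
have XX : Num.sqrt s * lil (tau k.+1) + expR (- (alpha * r)) * X (tau k) w <= X (tau k.+1) w.
  by rewrite -(ler_pM2l c0) mulrDr -lerBrDr [_ * (expR _ * _)]mulrA -cc.
have lil0 : 0 <= lil (tau k.+1) by exact: sqrtr_ge0.
have low : - (2 * y * lil (tau k.+1)) <= expR (- (alpha * r)) * X (tau k) w.
  have er := expR_gt0 (- (alpha * r)).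
  have h2 : expR (- (alpha * r)) * - X (tau k) w <=
      expR (- (alpha * r)) * (2 * (expR (r / 2) * lil (tau k.+1))).
    by rewrite ler_pM2l// (le_trans Xk)// ler_pM2l.
  have h3 : y = expR (- (alpha * r)) * expR (r / 2).
    by rewrite -yE -expRD; congr expR; field.
  rewrite lerNl -mulrN; apply: (le_trans h2); rewrite h3.
  by rewrite le_eqVlt; apply/orP; left; apply/eqP; ring.
have ss : s <= Num.sqrt s.
  rewrite -[leLHS](sqr_sqrtr s0) expr2 ler_piMl ?sqrtr_ge0//.
  by rewrite -[leRHS]sqrtr1; exact: ler_wsqrtr.
have key : 1 - h <= Num.sqrt s - 2 * y.
  apply: (@le_trans _ _ (s - 2 * y)); last by rewrite lerD2r.
  have hs : 1 - 6 * e - y <= s.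
    rewrite /s mulrBr mulr1; apply: lerB => //.
    apply: (@le_trans _ _ (y ^+ 2)); first by rewrite ler_piMl ?sqr_ge0.
    by rewrite expr2 ler_piMl// ltW.
  rewrite lerBrDr; apply: le_trans hs.
  by rewrite le_eqVlt; apply/orP; left; apply/eqP; rewrite /y /e; field.
apply: (le_trans (ler_wpM2r lil0 key)); apply: le_trans XX.
by rewrite mulrBl lerD2l.
Qed.

End lil_bounds.

(** * Limit superior at a left endpoint *)

Section limsup_left.
Context (R : realType) (T : R).
Implicit Types (f : R -> \bar R).

Lemma limf_esup_at_left_le f (b : \bar R) :
  (\forall t \near T^'-, (f t <= b)%E) -> (limf_esup f T^'- <= b)%E.
Proof.
move=> H; rewrite limf_esupE; apply: (@le_trans _ _ (ereal_sup (f @` [set t | f t <= b]%E))).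
  by apply: ereal_inf_lbound; exists [set t | (f t <= b)%E].
by apply: ge_ereal_sup => _ [t /= ft <-].
Qed.

Lemma limf_esup_at_left_ge f (b : \bar R) :
  (forall a, a < T -> exists2 t, a < t < T & (b <= f t)%E) ->
  (b <= limf_esup f T^'-)%E.
Proof.
move=> H; rewrite limf_esupE; apply: le_ereal_inf_tmp => _ [V FV <-].
case: FV => e /= e0 He.
have [|t /andP[et tT] bf] := H (T - e); first by rewrite gtrBl.
apply: (le_trans bf); apply: ereal_sup_ubound; exists t => //.
by apply: He => //=; rewrite gtr0_norm ?subr_gt0// ltrBlDr -ltrBlDl.
Qed.

(** The intervals ]a n, T[ are cofinal among the left neighbourhoods of T. *)
Lemma limf_esup_at_leftE f (a : nat -> R) :
  (forall n, a n < T) -> (forall b, b < T -> exists n, b <= a n) ->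
  limf_esup f T^'- = ereal_inf (range (fun n => ereal_sup (f @` `]a n, T[))).
Proof.
move=> aT aC; apply/eqP; rewrite eq_le; apply/andP; split.
  apply: le_ereal_inf_tmp => _ [n _ <-].
  apply: limf_esup_at_left_le; near=> t.
  apply: ereal_sup_ubound; exists t => //=; rewrite in_itv/=; apply/andP; split.
    by near: t; exact: nbhs_left_gt.
  by near: t; exact: nbhs_left_lt.
rewrite limf_esupE; apply: le_ereal_inf_tmp => _ [V [e /= e0 He] <-].
have [|n en] := aC (T - e); first by rewrite gtrBl.
apply: ge_ereal_inf; exists (ereal_sup (f @` `]a n, T[)); first by exists n.
apply: ereal_sup_le => _ [t /= + <-]; rewrite in_itv/= => /andP[at_ tT].
exists t => //; apply: He => //=.
by rewrite gtr0_norm ?subr_gt0// ltrBlDr -ltrBlDl (le_lt_trans en).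
Unshelve. all: by end_near. Qed.

Definition rational_point (m : nat) : R :=
  if unpickle m is Some q then ratr q else 0.

(** By continuity the supremum is approached along rational times; the value -oo is
    neutral at the indices that fall outside the interval. *)
Lemma ereal_sup_rational (f : R -> R) a : {within `]a, T[, continuous f} ->
  ereal_sup ((EFin \o f) @` `]a, T[) =
  ereal_sup (range (fun m => if a < rational_point m < T
    then (f (rational_point m))%:E else -oo%E)).
Proof.
move=> cf; apply/eqP; rewrite eq_le; apply/andP; split.
  apply: ge_ereal_sup => _ [t /= + <-]; rewrite in_itv/= => tI.
  apply/lee_addgt0Pr => e e0.
  have tI' : `]a, T[%classic t by rewrite /= in_itv.
  have [dl dl0 Hd] := within_continuous_eps cf tI' e0.
  have /andP[at_ tT] := tI.
  have lt1 : t < Num.min (t + dl) T by rewrite lt_min ltrDl dl0.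
  have [q] := rat_in_itvoo lt1.
  rewrite in_itv/= lt_min => /andP[tq /andP[qd qT]].
  have qm : rational_point (pickle q) = ratr q by rewrite /rational_point pickleK.
  have qI : a < rational_point (pickle q) < T by rewrite qm qT (lt_trans at_ tq).
  apply: (@le_trans _ _ ((f (ratr q))%:E + e%:E)%E).
    rewrite -EFinD lee_fin.
    have : `|f t - f (ratr q)| < e.
      apply: Hd; first by rewrite /= in_itv/= (lt_trans at_ tq).
      by rewrite ltr0_norm ?subr_lt0// opprB ltrBlDl.
    by rewrite ltr_norml => /andP[_ ?]; lra.
  rewrite leeD2r//; apply: ereal_sup_ubound; exists (pickle q) => //.
  by rewrite qI qm.
apply: ge_ereal_sup => _ [m _ <-]; case: ifPn => [mI|_]; last exact: leNye.
by apply: ereal_sup_ubound; exists (rational_point m) => //=; rewrite in_itv.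
Qed.

End limsup_left.

Section limsup_measurable.
Context d (Omega : measurableType d) (R : realType) (P : probability Omega R).
Variables (T a0 : R) (X : R -> Omega -> R) (h : R -> R).
Hypotheses (a0T : a0 < T) (mX : forall t, measurable_fun setT (X t)).
Hypothesis cX : forall w, {within `]a0, T[, continuous (X ^~ w)}.
Hypothesis ch : {within `]a0, T[, continuous h}.

Lemma measurable_limf_esup_left :
  measurable_fun setT (fun w => limf_esup (fun t => (X t w * h t)%:E) T^'-).
Proof.
pose a (n : nat) := T - (T - a0) / n.+1%:R.
have Ta : 0 < T - a0 by rewrite subr_gt0.
have aT n : a n < T by rewrite gtrBl divr_gt0.
have a0a n : a0 <= a n.
  rewrite lerBrDr -lerBrDl ler_piMr ?(ltW Ta)//.
  by rewrite invf_le1 ?ltr0n// ler1n.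
have aC b : b < T -> exists n, b <= a n.
  move=> bT; have Tb : 0 < T - b by rewrite subr_gt0.
  have [k k0 kM] := exists_natM_ge (T - a0) Tb.
  exists k.-1; rewrite /a prednK// lerBrDr -lerBrDl ler_pdivrMr ?ltr0n//.
  by rewrite mulrC.
(* -oo is neutral for the supremum over the rational times *)
pose F n m w : \bar R := if a n < rational_point R m < T
  then (X (rational_point R m) w * h (rational_point R m))%:E else -oo%E.
have mF n m : measurable_fun setT (F n m).
  rewrite /F; case: (a n < rational_point R m < T); last exact: measurable_cst.
  by apply/measurable_EFinP; apply: measurable_funM.
have -> : (fun w => limf_esup (fun t => (X t w * h t)%:E) T^'-) =
    (fun w => einfs (fun n => esups (fun m => F n m w) 0%N) 0%N).
  apply/funext => w; rewrite (limf_esup_at_leftE _ aT aC).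
  rewrite /einfs /sdrop /=; congr ereal_inf.
  have e n : ereal_sup ((fun t => (X t w * h t)%:E) @` `]a n, T[) =
      esups (fun m => F n m w) 0%N.
    rewrite /esups /sdrop /= (@ereal_sup_rational R T (fun t => X t w * h t)).
      congr ereal_sup; apply/seteqP; split => _ [m _ <-]; exists m => //.
    have sub : `]a n, T[%classic `<=` `]a0, T[%classic.
      by apply: subset_itvr; rewrite bnd_simp.
    have c1 := continuous_subspaceW sub (@cX w).
    have c2 := continuous_subspaceW sub ch.
    by move=> s; apply: cvgM; [exact: c1|exact: c2].
  by apply/seteqP; split => _ [n _ <-]; exists n => //; rewrite e.
apply: measurable_fun_einfs => n; apply: measurable_fun_esups => m.
exact: mF.
Qed.

Lemma limf_esup_left_prob1 (e : \bar R) :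
  {ae P, forall w, limf_esup (fun t => (X t w * h t)%:E) T^'- = e} ->
  P [set w | limf_esup (fun t => (X t w * h t)%:E) T^'- = e] = 1%E.
Proof.
move=> ae; set A := [set w | _].
have mA : measurable A.
  rewrite -[X in measurable X]setTI.
  exact: (measurable_limf_esup_left measurableT (emeasurable_set1 e)).
have N0 : P (~` A) = 0%E.
  by apply: measure_negligible; [exact: measurableC|].
rewrite -[A]setCK probability_setC; last exact: measurableC.
by rewrite [X in (_ - X)%E](_ : _ = 0%E) ?sube0.
Qed.

End limsup_measurable.

(** * Almost sure values of the limits superior *)

Section limsup_values.
Context d (Omega : measurableType d) (R : realType) (P : probability Omega R).
Variables (T alpha : R).
Local Notation g := (2 * alpha - 1).
Hypotheses (g0 : 0 < g) (T0 : 0 < T).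
Context (B X : R -> Omega -> R) (sol : gauss_solution P T alpha B X).

Lemma lil_gt0 t : t < T -> T - t < expR (- 1) -> 0 < lil T alpha t.
Proof.
move=> tT tl; have Tt : 0 < T - t by rewrite subr_gt0.
have l1 : 1 < ln (1 / (T - t)).
  by rewrite div1r lnV ?posrE// ltrNr -ltr_expR lnK ?posrE.
by rewrite sqrtr_gt0 mulr_gt0 ?ln_gt0// divr_gt0// mulr_gt0.
Qed.

Let eps (n : nat) : R := n.+2%:R^-1.
Let eps0 n : 0 < eps n. Proof. by rewrite invr_gt0. Qed.
Let eps1 n : eps n < 1. Proof. by rewrite invf_lt1// ltr1n. Qed.

Lemma exists_eps (e k : R) : 0 < k -> 0 < e -> exists n, k * eps n <= e.
Proof.
move=> k0 e0; have [n n0 nk] := exists_natM_ge k e0.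
exists n; rewrite /eps ler_pdivrMr// mulrC (le_trans nk)// ler_pM2r// ler_nat.
by rewrite leqW.
Qed.

(** The bounds hold almost surely for each margin, hence for all the margins
    1 / (n + 2) at once. *)
Lemma ae_limsup_lil :
  {ae P, forall w, limf_esup (fun t => (X t w / lil T alpha t)%:E) T^'- = 1%E}.
Proof.
have up : {ae P, forall w n, \forall t \near T^'-,
    X t w <= (1 + 7 * eps n) * lil T alpha t}.
  by apply: ae_foralln => n; exact: (lil_upper g0 T0 sol).
have low : {ae P, forall w n, forall a, a < T ->
    exists2 t, a < t < T & (1 - eps n) * lil T alpha t <= X t w}.
  by apply: ae_foralln => n; exact: (lil_lower g0 T0 sol).
apply: filterS2 up low => w up low; apply/eqP; rewrite eq_le; apply/andP; split.
  apply/lee_addgt0Pr => e e0; have [n ne] := exists_eps (ltr0n R 7) e0.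
  apply: limf_esup_at_left_le; near=> t.
  have tT : t < T by near: t; exact: nbhs_left_lt.
  have l0 : 0 < lil T alpha t.
    apply: lil_gt0 => //; near: t; exact/nbhs_left_ltBl/expR_gt0.
  rewrite -EFinD lee_fin ler_pdivrMr//.
  have Xt : X t w <= (1 + 7 * eps n) * lil T alpha t by near: t; exact: up.
  by rewrite (le_trans Xt)// ler_pM2r// lerD2l.
apply/lee_subgt0Pr => e e0; have [n ne] := exists_eps (ltr01 : 0 < 1 :> R) e0.
apply: limf_esup_at_left_ge => a aT.
have [|t /andP[+ tT] Xt] := low n (Num.max a (T - expR (- 1))).
  by rewrite gt_max aT gtrBl expR_gt0.
rewrite gt_max => /andP[at_ lt]; exists t; first by rewrite at_.
have l0 : 0 < lil T alpha t by apply: lil_gt0 => //; rewrite ltrBlDr -ltrBlDl.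
rewrite -EFinB lee_fin ler_pdivlMr//; apply: le_trans Xt.
by rewrite ler_pM2r// lerD2l lerN2 -[leLHS]mul1r.
Unshelve. all: by end_near. Qed.

(** With u = - ln (T - t) the quotient is a constant times
    sqrt (ln u) exp ((2 alpha - 1) u / 2). *)
Lemma lil_div_powR_ge (M : R) : exists2 a, a < T &
  forall t, a < t < T -> M <= lil T alpha t / (T - t) `^ alpha.
Proof.
pose k := Num.sqrt (2 / g).
have k0 : 0 < k by rewrite sqrtr_gt0 divr_gt0.
pose K := Num.max 1 (`|M| / k * 2 / g).
exists (T - expR (- expR K)); first by rewrite gtrBl expR_gt0.
move=> t /andP[at_ tT].
have Tt : 0 < T - t by rewrite subr_gt0.
have [u uE] : exists u, u = - ln (T - t) by exists (- ln (T - t)).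
have uK : expR K < u.
  rewrite uE ltrNr -ltr_expR lnK ?posrE//; rewrite ltrBlDr -ltrBlDl in at_ *.
  by [].
have tE : T - t = expR (- u) by rewrite uE opprK lnK ?posrE.
have K1 : 1 <= K by rewrite le_max lexx.
have lu : K <= ln u.
  by rewrite -[leLHS]expRK ler_ln ?posrE ?expR_gt0 ?(lt_trans _ uK) ?expR_gt0// ltW.
have lilE : k * expR (- u / 2) <= lil T alpha t.
  rewrite -[expR _]ger0_norm ?expR_ge0// -sqrtr_sqr -sqrtrM ?divr_ge0 ?(ltW g0)//.
  apply: ler_wsqrtr; rewrite tE div1r -expRN opprK expRK expr2 -expRD.
  rewrite (_ : - u / 2 + - u / 2 = - u); last by field.
  rewrite (_ : 2 * expR (- u) / g = 2 / g * expR (- u)); last by ring.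
  by rewrite ler_peMr ?(le_trans K1)// mulr_ge0 ?expR_ge0// divr_ge0// ltW.
have pE : (T - t) `^ alpha = expR (- (alpha * u)).
  by rewrite /powR gt_eqF// uE mulrN opprK.
rewrite pE -expRN opprK.
apply: (@le_trans _ _ (k * expR (g * u / 2))); last first.
  rewrite (_ : k * _ = k * expR (- u / 2) * expR (alpha * u)).
    by rewrite ler_wpM2r ?expR_ge0.
  by rewrite -[RHS]mulrA -expRD; congr (_ * expR _); field.
rewrite mulrC -ler_pdivrMr//.
have h1 : g * u / 2 <= expR (g * u / 2).
  by have := expR_ge1Dx (g * u / 2) => ?; lra.
apply: le_trans h1.
have h2 : K <= u.
  by have := expR_ge1Dx K => ?; lra.
have h3 : `|M| / k * 2 / g <= u by apply: le_trans h2; rewrite le_max lexx orbT.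
rewrite ler_pdivlMr// mulrC -[leRHS]mulrC -ler_pdivrMr//.
apply: le_trans h3; rewrite ler_pM2r ?invr_gt0// mulrC ler_pM2r//.
by rewrite ler_pM2r ?invr_gt0// ler_norm.
Qed.

Lemma ae_limsup_powR :
  {ae P, forall w, limf_esup (fun t => (X t w / (T - t) `^ alpha)%:E) T^'- = +oo%E}.
Proof.
have h0 : 0 < 2^-1 :> R by [].
have h1 : 2^-1 < 1 :> R by rewrite invf_lt1// ltr1n.
apply: filterS (lil_lower g0 T0 sol h0 h1) => w low.
apply/eqyP => M _.
apply: limf_esup_at_left_ge => a aT.
have [b bT Hb] := lil_div_powR_ge (2 * M).
have [|t /andP[+ tT] Xt] := low (Num.max a b); first by rewrite gt_max aT.
rewrite gt_max => /andP[at_ bt]; exists t; first by rewrite at_.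
rewrite lee_fin.
have p0 : 0 < ((T - t) `^ alpha)^-1 by rewrite invr_gt0 powR_gt0// subr_gt0.
have := Hb t; rewrite bt tT => /(_ isT) H.
have := ler_wpM2r (ltW p0) Xt.
apply: le_trans; rewrite -mulrA.
rewrite (_ : 1 - 2^-1 = 2^-1); last by field.
by rewrite ler_pdivlMl.
Qed.

End limsup_values.

(** * Strong solutions *)

Section gauss_solution_of_strong.
Context d (Omega : measurableType d) (R : realType) (P : probability Omega R).

(** The increments have standard deviation sqrt (t - s), and the integrated
    equation holds for almost all paths at all times. *)
Lemma strong_solution_gauss (B X : R -> {RV P >-> R}) (T alpha : R) :
  standard_wiener B -> 0 < T ->
  strong_solution B T (fun t x => - (alpha / (T - t)) * x) X ->
  gauss_solution P T alpha (fun t w => B t w) (fun t w => X t w).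
Proof.
move=> [_ iB nB cB] T0 [_ cX X0 eX]; split.
- by move=> t; exact: measurable_funPT.
- by move=> t; exact: measurable_funPT.
- exact: iB.
- move=> s t s0 st.
  have ts : 0 < Num.sqrt (t - s) by rewrite sqrtr_gt0 subr_gt0.
  rewrite -[X in gaussian_mgf _ _ X]sqr_sqrtr ?subr_ge0 ?(ltW st)//.
  apply: normal_gaussian_mgf; first by rewrite gt_eqF.
    by apply: measurable_funB; exact: measurable_funPT.
  by move=> A mA; exact: nB.
- apply: filterS3 cB X0 eX => w cBw X0w eXw.
  by apply: strong_solution_path => // t tT; have [] := eXw t tT.
Qed.

Lemma continuous_inv_lil (T alpha : R) : 0 < 2 * alpha - 1 ->
  {within `]T - expR (- 1), T[, continuous (fun t => (lil T alpha t)^-1)}.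
Proof.
move=> g0; apply: continuous_in_subspaceT => t /set_mem /=.
rewrite in_itv/= => /andP[at_ tT].
have tl : T - t < expR (- 1) by rewrite ltrBlDr -ltrBlDl.
have Tt : 0 < T - t by rewrite subr_gt0.
have iTt : 0 < 1 / (T - t) by rewrite divr_gt0.
have l1 : 1 < ln (1 / (T - t)).
  by rewrite div1r lnV ?posrE// ltrNr -ltr_expR lnK ?posrE.
have cTt : (fun s : R => T - s) s @[s --> t] --> T - t.
  by apply: cvgB; [exact: cvg_cst|exact: cvg_id].
have cinv : (fun s : R => 1 / (T - s)) s @[s --> t] --> 1 / (T - t).
  by apply: cvgM; [exact: cvg_cst|apply: cvgV; [rewrite gt_eqF|]].
have cln : ln (1 / (T - s)) @[s --> t] --> ln (1 / (T - t)).
  exact: (continuous_cvg _ (continuous_ln iTt) cinv).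
have clnln : ln (ln (1 / (T - s))) @[s --> t] --> ln (ln (1 / (T - t))).
  apply: (continuous_cvg _ (continuous_ln _) cln).
  exact: lt_trans l1.
apply: cvgV; first by rewrite gt_eqF// lil_gt0.
apply: continuous_cvg; first exact: sqrt_continuous.
apply: cvgM => //; apply: cvgM; last exact: cvg_cst.
by apply: cvgM => //; exact: cvg_cst.
Qed.

Lemma continuous_inv_powR (T alpha a : R) :
  {within `]a, T[, continuous (fun t => ((T - t) `^ alpha)^-1)}.
Proof.
have H : {within `]a, T[, continuous (ifactor T alpha)}.
  apply: derivable_within_continuous => t; rewrite in_itv/= => /andP[_ tT].
  have dc := is_derive_ifactor alpha tT.
  exact: ex_derive.
apply: subspace_eq_continuous H => t /set_mem /=.
rewrite in_itv/= => /andP[_ tT].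
by rewrite /from_subspace /ifactor mulNr expRN /powR gt_eqF// subr_gt0.
Qed.

End gauss_solution_of_strong.

Theorem theorem3p2 (R : realType) (d : measure_display)
    (Omega : measurableType d) (P : probability Omega R)
    (B : R -> {RV P >-> R}) (hB : standard_wiener B)
    (T : R) (hT : 0 < T) (alpha : R) (halpha : 1 / 2 < alpha)
    (X : R -> {RV P >-> R})
    (hX : strong_solution B T (fun t x => - (alpha / (T - t)) * x) X) :
  let lil t := Num.sqrt (2 * (T - t) / (2 * alpha - 1) * ln (ln (1 / (T - t)))) in
  (P [set w | limf_esup (fun t => (X t w / lil t)%:E) T^'- = 1%E] = 1%E /\
   P [set w | limf_einf (fun t => (X t w / lil t)%:E) T^'- = (-1)%:E] = 1%E) /\
  (P [set w | limf_esup (fun t => (X t w / (T - t) `^ alpha)%:E) T^'- = +oo%E] = 1%E /\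
   P [set w | limf_einf (fun t => (X t w / (T - t) `^ alpha)%:E) T^'- = -oo%E] = 1%E).
Proof.
move=> lilT.
have g0 : 0 < 2 * alpha - 1 by lra.
have sol := strong_solution_gauss hB hT hX.
have solN := gauss_solutionN sol.
pose XN t w := - X t w.
have [_ cX _ _] := hX.
pose a := Num.max 0 (T - expR (- 1)).
have aT : a < T by rewrite gt_max hT gtrBl expR_gt0.
have sub1 : `]a, T[%classic `<=` [set t | 0 <= t < T].
  move=> t /=; rewrite in_itv/= gt_max -andbA => /and3P[t0 _ tT].
  by rewrite tT ltW.
have sub2 : `]a, T[%classic `<=` `]T - expR (- 1), T[%classic.
  by apply: subset_itvr; rewrite bnd_simp le_max lexx orbT.
have cXa w : {within `]a, T[, continuous (fun t => X t w)}.
  exact: continuous_subspaceW (cX w).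
have cXNa w : {within `]a, T[, continuous (XN ^~ w)}.
  by have c1 := cXa w; move=> t; apply: cvgN; exact: c1.
have mX t : measurable_fun setT (X t) by exact: measurable_funPT.
have mXN t : measurable_fun setT (XN t) by exact: measurableT_comp.
have clil := continuous_subspaceW sub2 (continuous_inv_lil (T := T) g0).
have cpow := @continuous_inv_powR R T alpha a.
have einfE (h : R -> R) (e : \bar R) :
    [set w | limf_einf (fun t => (X t w / h t)%:E) T^'- = (- e)%E] =
    [set w | limf_esup (fun t => (XN t w / h t)%:E) T^'- = e].
  have E w : limf_einf (fun t => (X t w / h t)%:E) T^'- =
      (- limf_esup (fun t => (XN t w / h t)%:E) T^'-)%E.
    rewrite /limf_einf; congr (- limf_esup _ _)%E; apply/funext => t.
    by rewrite -EFinN /XN mulNr.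
  by apply/seteqP; split => w /=; rewrite E; [exact: oppe_inj|move=> ->].
split; split.
- exact: (limf_esup_left_prob1 aT mX cXa clil (ae_limsup_lil g0 hT sol)).
- rewrite (einfE _ 1%E).
  exact: (limf_esup_left_prob1 aT mXN cXNa clil (ae_limsup_lil g0 hT solN)).
- exact: (limf_esup_left_prob1 aT mX cXa cpow (ae_limsup_powR g0 hT sol)).
- rewrite (einfE _ +oo%E).
  exact: (limf_esup_left_prob1 aT mXN cXNa cpow (ae_limsup_powR g0 hT solN)).
Qed.
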